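(* Let $S$ be the curve $(2x+y)(y+x^2)(y-x^2)=0$. Its local braid monodromy $\beta$ at $(0,0)$ is: the two points $y=1$ and $y=-1$ of the fiber over $x=1$ do two counterclockwise full-twists, and the third point $y=-2$ does a counterclockwise full-twist around them. That is, $\beta$ is the braid induced by the motion in which first $\pm1$ rotate about $0$ by the angle $4\pi$ counterclockwise with $-2$ fixed, and then $-2$ makes one full counterclockwise revolution along the circle $|y|=2$ with $\pm1$ fixed. The induced relations are $$x_1x_3x_2=x_3x_2x_1,\qquad x_3x_2x_1x_3x_2=x_2x_3x_2x_1x_3,$$ where $\{x_1,x_2,x_3\}$ are the generators of the standard g-base.
   Context: Let $E=\{x\in\mathbb{C}:|x|\le 1\}$, $D=\{y\in\mathbb{C}:|y|\le 4\}$, and regard $S$ as a curve in $E\times D$. The projection of $S$ to $E$ has fibers of constant cardinality $n$ ($n=3$ here) except over $x=0$. Let $K\subset D$ be the set of $y$-coordinates of the points of $S$ over $x=1$. A motion of $K$ in $D$ consists of $n$ continuous functions $m_i:[0,1]\to D$ with $m_i(t)\ne m_j(t)$ for all $t$ and $i\neq j$, and $\{m_i(0)\}=\{m_i(1)\}=K$. It is realized by a continuous family of diffeomorphisms $D_t$ of $D$, $D_0=\mathrm{Id}$, equal to the identity on $\partial D$, with $D_t(m_i(0))=m_i(t)$; the braid induced by the motion is the class of $D_1$ in the braid group $B_n[D,K]$, the group of diffeomorphisms of $D$ preserving $K$ and equal to the identity on $\partial D$, two being identified if they induce the same automorphism of $\pi_1(D-K,u_0)$. The local braid monodromy $\beta$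 of $S$ at $(0,0)$ is the braid induced by the motion formed by the points of $S$ over $x=e^{2\pi i t}$, $0\le t\le 1$. Standard g-base: take the base point $u_0=-4i$ and let $p_1<\dots<p_n$ be the (real) points of $K$. The loop $x_i$ goes from $u_0$ along the straight segment to near $p_i$, once counterclockwise around $p_i$ on a small circle, and back. In a product of loops the left factor is traversed first. The group $\pi_1(D-K,u_0)$ is free on $x_1,\dots,x_n$. The relations induced by $\beta$ are $\beta(x_j)=x_j$, $j=1,\dots,n$. Saying that ''the induced relations are $R$'' means that $R$ and $\{\beta(x_j)=x_j\}_j$ have the same normal closure in the free group on $x_1,\dots,x_n$. *)

(* Defs.v *)
From HB Require Import structures.
From mathcomp Require Import all_boot all_order all_algebra.
From mathcomp Require Import generic_quotient.
From mathcomp Require Import all_classical all_reals all_analysis.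
From mathcomp Require Import complex ring lra.

Set Implicit Arguments.
Unset Strict Implicit.
Unset Printing Implicit Defensive.

Import Order.TTheory GRing.Theory Num.Theory numFieldNormedType.Exports.

Local Open Scope classical_set_scope.
Local Open Scope ring_scope.

Section within_continuity.

Lemma within_comp (X Y Z : topologicalType) (A : set X) (B : set Y)
    (f : X -> Y) (g : Y -> Z) :
  {within A, continuous f} -> (forall x, A x -> B (f x)) ->
  {within B, continuous g} -> {within A, continuous (g \o f)}.
Proof.
move=> /subspace_continuousP cf AB /subspace_continuousP cg.
apply/subspace_continuousP => x Ax; apply: cvg_trans (cg _ (AB _ Ax)).
move=> U /= wU; have := cf _ Ax _ wU.
by rewrite !nbhs_simpl/= /within/=; apply: filterS => y + Ay; apply => //; exact: AB.
Qed.

Lemma within_eq (X Y : topologicalType) (A : set X) (f g : X -> Y) :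
  (forall x, A x -> f x = g x) ->
  {within A, continuous f} -> {within A, continuous g}.
Proof.
by move=> fg; apply: subspace_eq_continuous => x; rewrite inE => /fg.
Qed.

Lemma continuous_pair (X Y Z : topologicalType) (f : X -> Y) (g : X -> Z) :
  continuous f -> continuous g -> continuous (fun x => (f x, g x)).
Proof. by move=> cf cg x; exact: (cvg_pair (cf x) (cg x)). Qed.

Lemma continuous_fst (X Y : topologicalType) : continuous (@fst X Y).
Proof. by move=> x; exact: cvg_fst. Qed.

Lemma continuous_snd (X Y : topologicalType) : continuous (@snd X Y).
Proof. by move=> x; exact: cvg_snd. Qed.

Lemma closed_setX (X Y : topologicalType) (A : set X) (B : set Y) :
  closed A -> closed B -> closed (A `*` B).
Proof.
move=> cA cB; have -> : A `*` B = fst @^-1` A `&` snd @^-1` B by [].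
by apply: closedI; apply: closed_comp => // x _;
  [exact: cvg_fst|exact: cvg_snd].
Qed.

Lemma continuous_compT (X Y Z : topologicalType) (f : X -> Y) (g : Y -> Z) :
  continuous f -> continuous g -> continuous (g \o f).
Proof. by move=> cf cg x; exact: continuous_comp (cf x) (cg _). Qed.

Variables (R : realType) (X T : topologicalType).

Lemma within_if_le (A : set X) (h : X -> R) (f g : X -> T) (c : R) :
  closed A -> continuous h ->
  {within A `&` [set x | h x <= c], continuous f} ->
  {within A `&` [set x | c <= h x], continuous g} ->
  (forall x, A x -> h x = c -> f x = g x) ->
  {within A, continuous (fun x => if h x <= c then f x else g x)}.
Proof.
move=> cA ch cf cg fg.
have -> : A = (A `&` [set x | h x <= c]) `|` (A `&` [set x | c <= h x]).
  rewrite -setIUr (_ : _ `|` _ = setT) ?setIT//.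
  by apply/seteqP; split => x //= _; apply/orP; exact: le_total.
apply: withinU_continuous.
- apply: closedI => //.
  exact: (closed_comp (fun x _ => ch x) (@closed_le _ c)).
- apply: closedI => //.
  exact: (closed_comp (fun x _ => ch x) (@closed_ge _ c)).
- by apply: within_eq cf => x [_ /= ->].
- apply: within_eq cg => x [Ax /= cx]; case: ifPn => // xc.
  by rewrite fg//; apply/eqP; rewrite eq_le xc.
Qed.

End within_continuity.

Section path.
Variables (R : realType) (T : topologicalType) (A : set T).
Local Notation I := (`[0, 1]%classic : set R).

Definition is_path (x y : T) (f : R -> T) :=
  [/\ {within I, continuous f}, forall t, I t -> A (f t), f 0 = x & f 1 = y].

(* relative to the endpoints, within A *)
Definition homotopic (f g : R -> T) :=
  exists H : R * R -> T,
    [/\ {within I `*` I, continuous H},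
        forall s t, I s -> I t -> A (H (s, t)),
        forall t, I t -> H (0, t) = f t /\ H (1, t) = g t
      & forall s, I s -> H (s, 0) = f 0 /\ H (s, 1) = f 1].

Definition concat (f g : R -> T) : R -> T :=
  fun t => if t <= 2^-1 then f (2 * t) else g (2 * t - 1).

Definition rev_path (f : R -> T) : R -> T := fun t => f (1 - t).

Lemma I0 : I 0. Proof. by rewrite /= in_itv/= lexx ler01. Qed.
Lemma I1 : I 1. Proof. by rewrite /= in_itv/= lexx ler01. Qed.
Lemma Irev t : I t -> I (1 - t).
Proof. by rewrite /= !in_itv/=; lra. Qed.

Lemma continuous_rev : continuous (fun t : R => 1 - t).
Proof. by move=> t; apply: cvgB; [exact: cvg_cst|exact: cvg_id]. Qed.

Lemma is_path_cst x : A x -> is_path x x (cst x).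
Proof. by move=> Ax; split => //; apply: continuous_subspaceT => ? ; exact: cvg_cst. Qed.

Lemma is_path_comp x y f (p : R -> R) : is_path x y f ->
  {within I, continuous p} -> (forall t, I t -> I (p t)) ->
  is_path (f (p 0)) (f (p 1)) (f \o p).
Proof.
move=> [cf Af _ _] cp Ip; split => //; first exact: within_comp cp Ip cf.
by move=> t /Ip/Af.
Qed.

Lemma is_path_rev x y f : is_path x y f -> is_path y x (rev_path f).
Proof.
move=> fP; have [_ _ f0 f1] := fP.
have -> : y = f (1 - 0) by rewrite subr0.
have -> : x = f (1 - 1) by rewrite subrr.
apply: (is_path_comp fP) => [|t]; last exact: Irev.
exact/continuous_subspaceT/continuous_rev.
Qed.

Lemma continuous_double : continuous (fun t : R => 2 * t).
Proof. by move=> t; apply: cvgMr; exact: cvg_id. Qed.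
Lemma continuous_doubleB : continuous (fun t : R => 2 * t - 1).
Proof. by move=> t; apply: cvgB; [exact: continuous_double|exact: cvg_cst]. Qed.

Lemma is_path_concat x y z f g :
  is_path x y f -> is_path y z g -> is_path x z (concat f g).
Proof.
move=> [cf Af f0 f1] [cg Ag g0 g1]; split.
- apply: (within_if_le (h := id)).
  + exact: itv_closed.
  + by move=> ?; exact: cvg_id.
  + apply: (@within_comp R R T _ I (fun t => 2 * t) f) => //.
      exact/continuous_subspaceT/continuous_double.
    by move=> t []/=; rewrite !in_itv/=; lra.
  + apply: (@within_comp R R T _ I (fun t => 2 * t - 1) g) => //.
      exact/continuous_subspaceT/continuous_doubleB.
    by move=> t []/=; rewrite !in_itv/=; lra.
  + by move=> t _ ->; rewrite mulfV// subrr f1 g0.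
- move=> t It; rewrite /concat; case: ifPn => [|/negP] th.
    by apply: Af; move: It; rewrite /= !in_itv/=; lra.
  by apply: Ag; move: It th; rewrite /= !in_itv/=; lra.
- by rewrite /concat mulr0 f0 invr_ge0 ler0n.
- rewrite /concat ifF; last by apply/negP; lra.
  by rewrite -g1; congr (g _); ring.
Qed.

Lemma homotopic_refl x y f : is_path x y f -> homotopic f f.
Proof.
move=> [cf Af _ _]; exists (f \o snd); split => //.
- apply: (@within_comp (R * R)%type R T _ I snd f) => //; last by move=> -[s t] [].
  by apply: continuous_subspaceT => ?; exact: cvg_snd.
- by move=> s t _; exact: Af.
Qed.

Lemma homotopic_sym x y f g : is_path x y f -> is_path x y g ->
  homotopic f g -> homotopic g f.
Proof.
move=> [_ _ f0 f1] [_ _ g0 g1] [H [cH AH H01 Hf]].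
exists (fun st => H (1 - st.1, st.2)); split.
- apply: (@within_comp (R * R)%type (R * R)%type T _ (I `*` I) (fun st => (1 - st.1, st.2)) H) => //.
  + apply/continuous_subspaceT/continuous_pair; last exact: continuous_snd.
    exact: continuous_compT (@continuous_fst R R) continuous_rev.
  + by move=> [s t] [/=] /Irev.
- by move=> s t /Irev; exact: AH.
- by move=> t It; rewrite /= subr0 subrr; have [-> ->] := H01 _ It.
- by move=> s /Irev/Hf /=; rewrite f0 f1 g0 g1.
Qed.

Lemma homotopic_trans x y f g h :
  is_path x y f -> is_path x y g -> is_path x y h ->
  homotopic f g -> homotopic g h -> homotopic f h.
Proof.
move=> [_ _ f0 f1] [_ _ g0 g1] [_ _ h0 h1] [H [cH AH H01 Hf]] [K [cK AK K01 Kf]].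
exists (fun st => if st.1 <= 2^-1 then H (2 * st.1, st.2)
                  else K (2 * st.1 - 1, st.2)); split.
- apply: (within_if_le (h := fst)).
  + by apply: closed_setX; exact: itv_closed.
  + by move=> ?; exact: cvg_fst.
  + apply: (@within_comp (R * R)%type (R * R)%type T _ (I `*` I) (fun st => (2 * st.1, st.2)) H) => //.
    * apply/continuous_subspaceT/continuous_pair; last exact: continuous_snd.
      exact: continuous_compT (@continuous_fst R R) continuous_double.
    * by move=> [s t] [[/=]]; rewrite !in_itv/=; split => //; lra.
  + apply: (@within_comp (R * R)%type (R * R)%type T _ (I `*` I) (fun st => (2 * st.1 - 1, st.2)) K) => //.
    * apply/continuous_subspaceT/continuous_pair; last exact: continuous_snd.
      exact: continuous_compT (@continuous_fst R R) continuous_doubleB.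
    * by move=> [s t] [[/=]]; rewrite !in_itv/=; split => //; lra.
  + move=> [s t] /= [/= Is It] ->; rewrite mulfV// subrr.
    by have [_ ->] := H01 _ It; have [-> _] := K01 _ It.
- move=> s t Is It /=; case: ifPn => [|/negP] sh.
    by apply: AH => //; move: Is; rewrite /= !in_itv/=; lra.
  by apply: AK => //; move: Is sh; rewrite /= !in_itv/=; lra.
- move=> t It /=; rewrite mulr0 invr_ge0 ler0n ifF; last by apply/negP; lra.
  rewrite (_ : 2 * 1 - 1 = 1); last by ring.
  by have [-> _] := H01 _ It; have [_ ->] := K01 _ It.
- move=> s Is /=; case: ifPn => [|/negP] sh.
    by apply: Hf; move: Is; rewrite /= !in_itv/=; lra.
  rewrite f0 f1 -g0 -g1.
  by apply: Kf; move: Is sh; rewrite /= !in_itv/=; lra.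
Qed.

Lemma homotopic_eq x y f g : is_path x y f -> is_path x y g ->
  (forall t, I t -> f t = g t) -> homotopic f g.
Proof.
move=> fP _ fg; have [H [cH AH H01 Hf]] := homotopic_refl fP.
by exists H; split => // t It; have [-> ->] := H01 _ It; rewrite fg.
Qed.

Lemma homotopic_reparam x y f (p q : R -> R) : is_path x y f ->
  continuous p -> continuous q ->
  (forall t, I t -> I (p t)) -> (forall t, I t -> I (q t)) ->
  p 0 = q 0 -> p 1 = q 1 -> homotopic (f \o p) (f \o q).
Proof.
move=> [cf Af _ _] cp cq Ip Iq pq0 pq1.
have Ih s t : I s -> I t -> I ((1 - s) * p t + s * q t).
  move=> Is It; move: (Ip _ It) (Iq _ It) Is; rewrite /= !in_itv/=.
  move=> /andP[p0 p1] /andP[q0 q1] /andP[s0 s1]; apply/andP; split; nra.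
exists (fun st => f ((1 - st.1) * p st.2 + st.1 * q st.2)); split.
- apply: (@within_comp (R * R)%type R T _ I
    (fun st => (1 - st.1) * p st.2 + st.1 * q st.2) f) => //; last first.
    by move=> [s t] [/= Is It]; exact: Ih.
  apply: continuous_subspaceT => st; apply: cvgD; apply: cvgM.
  + by apply: cvgB; [exact: cvg_cst|exact: cvg_fst].
  + exact: (continuous_compT (@continuous_snd R R) cp).
  + exact: cvg_fst.
  + exact: (continuous_compT (@continuous_snd R R) cq).
- by move=> s t Is It; apply: Af; exact: Ih.
- by move=> t _ /=; split; congr (f _); ring.
- by move=> s _ /=; rewrite pq0 pq1; split; congr (f _); ring.
Qed.

Lemma homotopic_concat x y z f f' g g' :
  is_path x y f -> is_path x y f' -> is_path y z g -> is_path y z g' ->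
  homotopic f f' -> homotopic g g' -> homotopic (concat f g) (concat f' g').
Proof.
move=> [_ _ f0 f1] [_ _ f'0 f'1] [_ _ g0 g1] [_ _ g'0 g'1].
move=> [H [cH AH H01 Hf]] [K [cK AK K01 Kf]].
exists (fun st => if st.2 <= 2^-1 then H (st.1, 2 * st.2)
                  else K (st.1, 2 * st.2 - 1)); split.
- apply: (within_if_le (h := snd)).
  + by apply: closed_setX; exact: itv_closed.
  + by move=> ?; exact: cvg_snd.
  + apply: (@within_comp (R * R)%type (R * R)%type T _ (I `*` I) (fun st => (st.1, 2 * st.2)) H) => //.
    * apply/continuous_subspaceT/continuous_pair; first exact: continuous_fst.
      exact: continuous_compT (@continuous_snd R R) continuous_double.
    * by move=> [s t] [[/=]]; rewrite !in_itv/=; split => //; lra.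
  + apply: (@within_comp (R * R)%type (R * R)%type T _ (I `*` I) (fun st => (st.1, 2 * st.2 - 1)) K) => //.
    * apply/continuous_subspaceT/continuous_pair; first exact: continuous_fst.
      exact: continuous_compT (@continuous_snd R R) continuous_doubleB.
    * by move=> [s t] [[/=]]; rewrite !in_itv/=; split => //; lra.
  + move=> [s t] /= [/= Is It] ->; rewrite mulfV// subrr.
    by have [_ ->] := Hf _ Is; have [-> _] := Kf _ Is; rewrite f1 g0.
- move=> s t Is It /=; case: ifPn => [|/negP] sh.
    by apply: AH => //; move: It; rewrite /= !in_itv/=; lra.
  by apply: AK => //; move: It sh; rewrite /= !in_itv/=; lra.
- move=> t It /=; rewrite /concat; case: ifPn => [|/negP] sh.
    by apply: H01; move: It; rewrite /= !in_itv/=; lra.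
  by apply: K01; move: It sh; rewrite /= !in_itv/=; lra.
- move=> s Is /=; rewrite /concat !mulr0 !invr_ge0 ler0n ifF; last first.
    by apply/negP; lra.
  have -> : (1 <= 2^-1 :> R) = false by apply/negP; lra.
  rewrite (_ : 2 * 1 - 1 = 1 :> R); last by ring.
  by have [-> _] := Hf _ Is; have [_ ->] := Kf _ Is.
Qed.

Lemma homotopic_rev x y f f' : is_path x y f -> is_path x y f' ->
  homotopic f f' -> homotopic (rev_path f) (rev_path f').
Proof.
move=> [_ _ f0 f1] [_ _ f'0 f'1] [H [cH AH H01 Hf]].
exists (fun st => H (st.1, 1 - st.2)); split.
- apply: (@within_comp (R * R)%type (R * R)%type T _ (I `*` I) (fun st => (st.1, 1 - st.2)) H) => //.
  + apply/continuous_subspaceT/continuous_pair; first exact: continuous_fst.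
    exact: continuous_compT (@continuous_snd R R) continuous_rev.
  + by move=> [s t] [/= ? /Irev].
- by move=> s t ? /Irev; exact: AH.
- by move=> t /Irev/H01.
- by move=> s /Hf[? ?]; rewrite /rev_path !subr0 !subrr.
Qed.

Lemma concatA x y z w f g h :
  is_path x y f -> is_path y z g -> is_path z w h ->
  homotopic (concat f (concat g h)) (concat (concat f g) h).
Proof.
move=> fP gP hP.
pose p t : R := Num.min (2 * t) (Num.min (t + 4^-1) (2^-1 * t + 2^-1)).
have fghP := is_path_concat fP (is_path_concat gP hP).
have fghP' := is_path_concat (is_path_concat fP gP) hP.
have cp : continuous p.
  move=> t; apply: continuous_min; first exact: continuous_double.
  apply: continuous_min; apply: cvgD; try exact: cvg_cst; first exact: cvg_id.
  by apply: cvgMr; exact: cvg_id.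
have Ip t : I t -> I (p t).
  rewrite /= !in_itv/= /p => /andP[t0 t1].
  rewrite !le_min !ge_min; apply/andP; split; last by lra.
  by apply/and3P; split; lra.
have pE t : concat (concat f g) h t = concat f (concat g h) (p t).
  rewrite /concat /p; case: (leP t 2^-1) => th; last first.
    rewrite (min_r (_ : 2^-1 * t + 2^-1 <= t + 4^-1)); last by lra.
    rewrite min_r; last by lra.
    rewrite ifF; last by apply/negP; lra.
    rewrite ifF; last by apply/negP; lra.
    by congr (h _); field.
  rewrite (min_l (_ : t + 4^-1 <= 2^-1 * t + 2^-1)); last by lra.
  case: (leP (2 * t) 2^-1) => tq.
    rewrite min_l; last by lra.
    by rewrite ifT//; lra.
  rewrite min_r; last by lra.
  rewrite ifF; last by apply/negP; lra.
  rewrite ifT; last by lra.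
  by congr (g _); field.
have -> : concat (concat f g) h = concat f (concat g h) \o p by exact/funext.
apply: (homotopic_reparam fghP (p := id) (q := p)) => //.
- by move=> ?; exact: cvg_id.
- by rewrite /p mulr0 add0r min_l// le_min; apply/andP; split; lra.
- rewrite /p (min_r (_ : 2^-1 * 1 + 2^-1 <= 1 + 4^-1)); last by lra.
  by rewrite min_r; lra.
Qed.

Lemma concat1p x y f : is_path x y f -> homotopic (concat (cst x) f) f.
Proof.
move=> fP; have [_ _ f0 _] := fP.
pose p t : R := Num.max 0 (2 * t - 1).
have -> : concat (cst x) f = f \o p.
  apply/funext => t; rewrite /concat /p /=; case: leP => th.
    by rewrite max_l ?f0//; lra.
  by rewrite max_r//; lra.
apply: (homotopic_reparam fP (q := id)) => //.
- move=> t; exact: (@continuous_max R R (fun=> 0) (fun t => 2 * t - 1) t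
    (@cst_continuous _ _ _ _) (@continuous_doubleB t)).
- by move=> ?; exact: cvg_id.
- move=> t; rewrite /= !in_itv/= /p => /andP[t0 t1].
  by rewrite le_max lexx/= ge_max ler01/=; lra.
- by rewrite /p max_l//; lra.
- by rewrite /p max_r; lra.
Qed.

Lemma concatp1 x y f : is_path x y f -> homotopic (concat f (cst y)) f.
Proof.
move=> fP; have [_ _ _ f1] := fP.
pose p t : R := Num.min (2 * t) 1.
have -> : concat f (cst y) = f \o p.
  apply/funext => t; rewrite /concat /p /=; case: leP => th.
    by rewrite min_l//; lra.
  by rewrite min_r ?f1//; lra.
apply: (homotopic_reparam fP (q := id)) => //.
- move=> t; exact: (@continuous_min R R (fun t => 2 * t) (fun=> 1) t
    (@continuous_double t) (@cst_continuous _ _ _ _)).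
- by move=> ?; exact: cvg_id.
- move=> t; rewrite /= !in_itv/= /p => /andP[t0 t1].
  by rewrite ge_min lexx orbT le_min ler01 !andbT; lra.
- by rewrite /p min_l//; lra.
- by rewrite /p min_r; lra.
Qed.

Lemma concatpV x y f : is_path x y f ->
  homotopic (concat f (rev_path f)) (cst x).
Proof.
move=> fP; have [_ _ f0 f1] := fP.
pose p t : R := Num.min (2 * t) (2 - 2 * t).
have -> : concat f (rev_path f) = f \o p.
  apply/funext => t; rewrite /concat /rev_path /p /=; case: leP => th.
    by rewrite min_l//; lra.
  by rewrite min_r; [congr (f _); ring|lra].
have -> : (cst x : R -> T) = f \o (cst 0 : R -> R) by apply/funext => t /=; rewrite f0.
apply: (homotopic_reparam fP) => //.
- move=> t; apply: (@continuous_min R R (fun t => 2 * t) (fun t => 2 - 2 * t) t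
    (@continuous_double t)).
  by apply: cvgB; [exact: cvg_cst|exact: continuous_double].
- by move=> ?; exact: cvg_cst.
- move=> t; rewrite /= !in_itv/= /p => /andP[t0 t1].
  rewrite le_min ge_min; apply/andP; split; first by apply/andP; split; lra.
  by apply/orP; case: (leP t 2^-1) => ?; [left|right]; lra.
- by move=> t _; exact: I0.
- by rewrite /p mulr0 min_l//; lra.
- by rewrite /p /cst min_r; lra.
Qed.

Lemma concatVp x y f : is_path x y f ->
  homotopic (concat (rev_path f) f) (cst y).
Proof.
move=> fP; have := concatpV (is_path_rev fP).
by rewrite (_ : rev_path (rev_path f) = f)//; apply/funext => t;
  rewrite /rev_path subKr.
Qed.

End path.

Section fundamental_group.
Local Open Scope quotient_scope.
Variables (R : realType) (T : topologicalType) (A : set T) (x0 : A).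
Local Notation I := (`[0, 1]%classic : set R).
Local Notation b := (\val x0).

(* Only the values on [0, 1] matter; the others are quotiented out in pi1. *)
Record loop := Loop {
  loop_fun :> R -> T;
  loopP : is_path A b b loop_fun }.

HB.instance Definition _ := gen_eqMixin loop.
HB.instance Definition _ := gen_choiceMixin loop.

Lemma base_in : A b. Proof. exact: set_valP. Qed.

Definition loop1 := Loop (is_path_cst R base_in).
Definition loopM (f g : loop) := Loop (is_path_concat (loopP f) (loopP g)).
Definition loopV (f : loop) := Loop (is_path_rev (loopP f)).

Definition loop_equiv (f g : loop) : bool := `[< homotopic A f g >].

Lemma loop_equiv_refl : reflexive loop_equiv.
Proof. by move=> f; apply/asboolP; exact: homotopic_refl (loopP f). Qed.

Lemma loop_equiv_sym : symmetric loop_equiv.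
Proof.
by move=> f g; apply/asboolP/asboolP; apply: homotopic_sym;
  solve [exact: loopP].
Qed.

Lemma loop_equiv_trans : transitive loop_equiv.
Proof.
move=> g f h /asboolP fg /asboolP gh; apply/asboolP.
exact: homotopic_trans (loopP f) (loopP g) (loopP h) fg gh.
Qed.

Canonical loop_equiv_rel :=
  EquivRel loop_equiv loop_equiv_refl loop_equiv_sym loop_equiv_trans.

Definition pi1 := {eq_quot loop_equiv}.

HB.instance Definition _ := Choice.on pi1.
HB.instance Definition _ := EqQuotient.on pi1.

Definition pi1_class (f : loop) : pi1 := \pi_pi1 f.

Lemma pi1_classP (f g : loop) : pi1_class f = pi1_class g <-> homotopic A f g.
Proof.
split=> [/eqmodP/asboolP//|fg].
by apply/eqmodP/asboolP.
Qed.

Lemma pi1_ind (P : pi1 -> Prop) : (forall f, P (pi1_class f)) -> forall g, P g.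
Proof. by move=> Pf g; rewrite -[g]reprK; exact: Pf. Qed.

Definition pi1_one : pi1 := pi1_class loop1.
Definition pi1_mul (g h : pi1) : pi1 := pi1_class (loopM (repr g) (repr h)).
Definition pi1_inv (g : pi1) : pi1 := pi1_class (loopV (repr g)).

Lemma pi1_reprP (f : loop) : homotopic A (repr (pi1_class f)) f.
Proof. by apply/pi1_classP; rewrite /pi1_class reprK. Qed.

Lemma pi1_mulE f g : pi1_mul (pi1_class f) (pi1_class g) = pi1_class (loopM f g).
Proof.
apply/pi1_classP; apply: homotopic_concat; try exact: loopP;
  exact: pi1_reprP.
Qed.

Lemma pi1_invE f : pi1_inv (pi1_class f) = pi1_class (loopV f).
Proof.
by apply/pi1_classP; apply: homotopic_rev; try exact: loopP; exact: pi1_reprP.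
Qed.

Lemma pi1_mulA : associative pi1_mul.
Proof.
elim/pi1_ind => f; elim/pi1_ind => g; elim/pi1_ind => h.
rewrite !pi1_mulE; apply/pi1_classP.
exact: concatA (loopP f) (loopP g) (loopP h).
Qed.

Lemma pi1_mul1g : left_id pi1_one pi1_mul.
Proof.
elim/pi1_ind => f; rewrite pi1_mulE; apply/pi1_classP.
exact: concat1p (loopP f).
Qed.

Lemma pi1_mulg1 : right_id pi1_one pi1_mul.
Proof.
elim/pi1_ind => f; rewrite pi1_mulE; apply/pi1_classP.
exact: concatp1 (loopP f).
Qed.

Lemma pi1_mulVg : left_inverse pi1_one pi1_inv pi1_mul.
Proof.
elim/pi1_ind => f; rewrite pi1_invE pi1_mulE; apply/pi1_classP.
exact: concatVp (loopP f).
Qed.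

Lemma pi1_mulgV : right_inverse pi1_one pi1_inv pi1_mul.
Proof.
elim/pi1_ind => f; rewrite pi1_invE pi1_mulE; apply/pi1_classP.
exact: concatpV (loopP f).
Qed.

HB.instance Definition _ := isGroup.Build pi1
  pi1_mulA pi1_mul1g pi1_mulg1 pi1_mulVg pi1_mulgV.

Lemma pi1_classM f g :
  (pi1_class f * pi1_class g)%g = pi1_class (loopM f g).
Proof. exact: pi1_mulE. Qed.

Lemma pi1_classV f : (pi1_class f)^-1%g = pi1_class (loopV f).
Proof. exact: pi1_invE. Qed.

End fundamental_group.

Section pi1_map.
Local Open Scope quotient_scope.
Variables (R : realType) (T : topologicalType) (A : set T) (x0 : A).
Local Notation b := (\val x0).

Definition based_map (phi : T -> T) :=
  [/\ {within A, continuous phi}, forall z, A z -> A (phi z) & phi b = b].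

Lemma based_map_path phi (f : R -> T) : based_map phi ->
  is_path A b b f -> is_path A b b (phi \o f).
Proof.
move=> [cphi Aphi phib] [cf Af f0 f1]; split.
- exact: within_comp cf Af cphi.
- by move=> t /Af/Aphi.
- by rewrite /= f0.
- by rewrite /= f1.
Qed.

Definition loop_map phi (hphi : based_map phi) (f : loop R x0) : loop R x0 :=
  Loop (based_map_path hphi (loopP f)).

Definition pi1_map phi (hphi : based_map phi) (g : pi1 R x0) : pi1 R x0 :=
  pi1_class (loop_map hphi (repr g)).

Lemma pi1_mapE phi (hphi : based_map phi) f :
  pi1_map hphi (pi1_class f) = pi1_class (loop_map hphi f).
Proof.
apply/pi1_classP => /=; have [H [cH AH H01 Hf]] := pi1_reprP f.
case: hphi => cphi Aphi phib; exists (phi \o H); split.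
- apply: (@within_comp (R * R)%type T T _ A H phi) => //.
  by move=> [s t] [/= Is It]; exact: AH.
- by move=> s t Is It; exact/Aphi/AH.
- by move=> t It /=; have [-> ->] := H01 _ It.
- by move=> s Is /=; have [-> ->] := Hf _ Is.
Qed.

Lemma pi1_mapM phi (hphi : based_map phi) (g h : pi1 R x0) :
  pi1_map hphi (g * h)%g = (pi1_map hphi g * pi1_map hphi h)%g.
Proof.
elim/pi1_ind: g => f; elim/pi1_ind: h => g.
rewrite pi1_classM !pi1_mapE pi1_classM.
apply/pi1_classP; apply: homotopic_eq; try exact: loopP.
by move=> t _; rewrite /= /concat; case: ifP.
Qed.

End pi1_map.

Section normal_closure.
Variable G : groupType.

Definition normal_subgroup (N : set G) :=
  [/\ N 1%g, forall g h, N g -> N h -> N (g * h)%g,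
      forall g, N g -> N (g^-1)%g & forall g h, N g -> N (g ^ h)%g].

Definition normal_closure (X : set G) : set G :=
  \bigcap_(N in [set N | normal_subgroup N /\ X `<=` N]) N.

(* the pair (g, h) stands for the relation g = h *)
Definition relation_closure (rels : set (G * G)) : set G :=
  normal_closure [set (e.1 * e.2^-1)%g | e in rels].

End normal_closure.

Section class_C.
Variables (R : realType) (V W : normedModType R).

(* C^k on the whole space: f is differentiable and each of its directional
   derivatives is C^(k-1). *)
Fixpoint class_C (k : nat) (f : V -> W) : Prop :=
  if k is k'.+1 then
    (forall x, differentiable f x) /\ (forall v, class_C k' (fun x => 'd f x v))
  else continuous f.

(* C^infinity on a closed set: restriction of a C^infinity map. *)
Definition smooth_on (A : set V) (f : V -> W) :=
  exists2 F : V -> W, forall k, class_C k F & forall x, A x -> F x = f x.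

Lemma smooth_on_continuous A f : smooth_on A f -> {within A, continuous f}.
Proof.
by move=> [F CF Ff]; apply: within_eq Ff _; exact: continuous_subspaceT (CF 0%N).
Qed.

End class_C.

(* [Rcomplex R] is the field of complex numbers seen as a real vector space with
   the (real-valued) modulus as norm; we give it the topology of that norm. *)
Section complex_topology.
Variable R : realType.

HB.instance Definition _ :=
  PseudoMetric.copy (Rcomplex R) (pseudoMetric_normed (Rcomplex R)).
HB.instance Definition _ := isPointed.Build (Rcomplex R) 0.
HB.instance Definition _ :=
  NormedZmod_PseudoMetric_eq.Build R (Rcomplex R) erefl.

Lemma normcZ (l : R) (z : Rcomplex R) : `|l *: z| = `|l| * `|z|.
Proof.
case: z => a b; rewrite /Num.norm/= !exprMn -mulrDr sqrtrM ?sqr_ge0//.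
by rewrite sqrtr_sqr.
Qed.

HB.instance Definition _ :=
  PseudoMetricNormedZmod_Lmodule_isNormedModule.Build R (Rcomplex R) normcZ.

End complex_topology.

Section plane.
Variable R : realType.
Local Notation C := (Rcomplex R).
Local Notation I := (`[0, 1]%classic : set R).

Definition discE : set C := [set x | `|x| <= 1].
Definition discD : set C := [set y | `|y| <= 4].
Definition bdD : set C := [set y | `|y| = 4].

Definition toC (a : R) : C := Complex a 0.

(* e^(i t) *)
Definition cis (t : R) : C := Complex (cos t) (sin t).

(* the base point -4i *)
Definition u0 : C := Complex 0 (- 4).

Lemma bdD_u0 : bdD u0.
Proof.
by rewrite /bdD/= /Num.norm/= expr0n add0r sqrrN sqrtr_sqr ger0_norm.
Qed.

Definition segment (a b : C) : R -> C := fun t => a + t *: (b - a).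

(* constant speed rotation of a about p by the angle theta *)
Definition rotation (p a : C) (theta : R) : R -> C :=
  fun t => p + cis (theta * t) * (a - p).

(* from u straight towards p up to distance r, once counterclockwise around p,
   and back *)
Definition lasso (u p : C) (r : R) : R -> C :=
  let a := p + (r / `|u - p|) *: (u - p) in
  concat (segment u a) (concat (rotation p a (2 * pi)) (segment a u)).

Definition diffeoD (phi : C -> C) :=
  smooth_on discD phi /\
  exists psi, [/\ smooth_on discD psi,
    forall z, discD z -> discD (phi z), forall z, discD z -> discD (psi z),
    forall z, discD z -> psi (phi z) = z & forall z, discD z -> phi (psi z) = z].

Lemma norm_cis t : `|cis t| = 1.
Proof. by rewrite /Num.norm/= cos2Dsin2 sqrtr1. Qed.

(* Without the cast, the norm of R[i] (with values in R[i]) is inferred. *)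
Lemma normCM (z w : C) : `|z * w : C| = `|z| * `|w| :> R.
Proof. exact: ComplexField.Normc.normcM. Qed.

Lemma norm_toC a : `|toC a| = `|a|.
Proof. by rewrite /Num.norm/= expr0n addr0 sqrtr_sqr. Qed.

Lemma continuous_segment a b : continuous (segment a b).
Proof.
by move=> t; apply: cvgD; [exact: cvg_cst|apply: cvgZr_tmp; exact: cvg_id].
Qed.

Lemma continuous_rotation p a theta : continuous (rotation p a theta).
Proof.
have -> : rotation p a theta = fun t => p +
    (cos (theta * t) *: (a - p) + sin (theta * t) *: ((Complex 0 1 : C) * (a - p))).
  apply/funext => t; rewrite /rotation; congr (_ + _).
  by case: (a - p) => x y; apply/eqP; rewrite eq_complex/=;
    apply/andP; split; apply/eqP; ring.
move=> t; apply: cvgD; first exact: cvg_cst.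
by apply: cvgD; apply: cvgZr_tmp; [apply: (continuous_comp (f := fun t => theta * t));
   [apply: cvgMr; exact: cvg_id|exact: continuous_cos]|
   apply: (continuous_comp (f := fun t => theta * t));
   [apply: cvgMr; exact: cvg_id|exact: continuous_sin]].
Qed.

End plane.

Section braid.
Local Open Scope quotient_scope.
Variable R : realType.
Local Notation C := (Rcomplex R).
Local Notation D := (@discD R).
Local Notation I := (`[0, 1]%classic : set R).
Variables (K : set C) (Ku0 : ~ K (u0 R)).

Lemma u0_subproof : u0 R \in D `\` K.
Proof. by rewrite inE; split => //; rewrite /discD/= bdD_u0. Qed.

Definition base : D `\` K := exist _ (u0 R) u0_subproof.

(* Values outside of D are irrelevant: two maps equal on D induce the same map on
   the fundamental group, hence define the same braid below. *)
Record braid_diffeo := BraidDiffeo {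
  braid_fun :> C -> C;
  braid_diffeoD : diffeoD braid_fun;
  braid_bdD : forall z, bdD z -> braid_fun z = z;
  braid_K : braid_fun @` (D `&` K) = K }.

HB.instance Definition _ := gen_eqMixin braid_diffeo.
HB.instance Definition _ := gen_choiceMixin braid_diffeo.

Lemma braid_based (phi : braid_diffeo) : based_map base phi.
Proof.
have [sphi [psi [_ phiD psiD psiK phiK]]] := braid_diffeoD phi.
split; last exact/braid_bdD/bdD_u0.
- by apply: continuous_subspaceW (smooth_on_continuous sphi) => z [].
- move=> z [Dz Kz]; split; first exact: phiD.
  rewrite -{1}(braid_K phi) => -[w [Dw Kw] wz]; apply: Kz.
  by rewrite -(psiK _ Dz) -wz psiK.
Qed.

Definition braid_diffeo_pi1 (phi : braid_diffeo) : pi1 R base -> pi1 R base :=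
  pi1_map (braid_based phi).

Definition braid_equiv (phi psi : braid_diffeo) : bool :=
  `[< braid_diffeo_pi1 phi = braid_diffeo_pi1 psi >].

Lemma braid_equiv_refl : reflexive braid_equiv.
Proof. by move=> phi; apply/asboolP. Qed.

Lemma braid_equiv_sym : symmetric braid_equiv.
Proof. by move=> phi psi; apply/asboolP/asboolP => ->. Qed.

Lemma braid_equiv_trans : transitive braid_equiv.
Proof.
by move=> psi phi chi /asboolP e1 /asboolP e2; apply/asboolP; rewrite e1.
Qed.

Canonical braid_equiv_rel :=
  EquivRel braid_equiv braid_equiv_refl braid_equiv_sym braid_equiv_trans.

Definition braid := {eq_quot braid_equiv}.

HB.instance Definition _ := Choice.on braid.
HB.instance Definition _ := EqQuotient.on braid.

Definition braid_class (phi : braid_diffeo) : braid := \pi_braid phi.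

Definition braid_act (beta : braid) : pi1 R base -> pi1 R base :=
  braid_diffeo_pi1 (repr beta).

Lemma braid_actE phi : braid_act (braid_class phi) = braid_diffeo_pi1 phi.
Proof.
suff /eqmodP/asboolP : repr (braid_class phi) = phi %[mod braid] by [].
by rewrite reprK.
Qed.

Definition motion (n : nat) (m : 'I_n -> R -> C) :=
  [/\ forall i, {within I, continuous (m i)},
      forall i t, I t -> D (m i t),
      forall i j t, I t -> i != j -> m i t <> m j t,
      range (m^~ 0) = K & range (m^~ 1) = K].

(* The continuity of the family is joint continuity in (t, z). *)
Definition realizes (n : nat) (m : 'I_n -> R -> C) (Phi : R -> C -> C) :=
  [/\ {within I `*` D, continuous (fun tz => Phi tz.1 tz.2)},
      forall t, I t -> diffeoD (Phi t) /\ (forall z, bdD z -> Phi t z = z),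
      forall z, D z -> Phi 0 z = z
    & forall i t, I t -> Phi t (m i 0) = m i t].

Definition induced_braid (n : nat) (m : 'I_n -> R -> C) (beta : braid) :=
  motion m /\
  exists Phi (phi : braid_diffeo),
    [/\ realizes m Phi, forall z, D z -> phi z = Phi 1 z
      & beta = braid_class phi].

End braid.

Section curve.
Variable R : realType.
Local Notation C := (Rcomplex R).
Local Notation D := (@discD R).
Local Notation I := (`[0, 1]%classic : set R).

Definition fiber (S : set (C * C)) (x : C) : set C := [set y | S (x, y)].

(* the points of S over x = e^(2 pi i t), where n is the number of those points *)
Definition local_braid_monodromy (n : nat) (S : set (C * C))
    (Ku0 : ~ fiber S 1 (u0 R)) (beta : braid Ku0) :=
  exists m : 'I_n -> R -> C,
    (forall t, I t -> range (m^~ t) = fiber S (cis (2 * pi * t))) /\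
    induced_braid m beta.

Definition curveS : set (C * C) :=
  [set p | [/\ discE p.1, discD p.2
    & (2 * p.1 + p.2) * (p.2 + p.1 ^+ 2) * (p.2 - p.1 ^+ 2) = 0]].

Definition pt (i : 'I_3) : R := [tuple -2; -1; 1]`_i.

Lemma toCN1 : toC (- 1) = - 1 :> C.
Proof. by apply/eqP; rewrite eq_complex/= oppr0 !eqxx. Qed.

Lemma toCN2 : toC (- 2) = - 2 :> C.
Proof. by apply/eqP; rewrite eq_complex/= addr0 oppr0 !eqxx. Qed.

Lemma pt_norm i : `|pt i| <= 2.
Proof.
by case: i => -[|[|[|//]]] ?; rewrite /pt /=; rewrite ?normrN ger0_norm//; lra.
Qed.

Lemma curveS_fiber1 y : fiber curveS 1 y <-> exists i, y = toC (pt i).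
Proof.
rewrite /fiber/curveS/= expr1n mulr1; split.
  move=> [_ _ /eqP]; rewrite !mulf_eq0 -orbA => /or3P[] /eqP h.
  - by exists ord0; rewrite /pt/= toCN2; apply/eqP; rewrite -addr_eq0 addrC h.
  - by exists 1; rewrite /pt/= toCN1; apply/eqP; rewrite -addr_eq0 h.
  - by exists 2; rewrite /pt/=; apply/eqP; rewrite -subr_eq0 -[toC 1]/(1 : C) h.
move=> [i yE]; split.
- by rewrite /discE/= -[1 in X in X <= _]/(toC 1 : C) norm_toC normr1.
- by rewrite /discD/= yE norm_toC (le_trans (pt_norm i))//; lra.
- rewrite yE; case: i {yE} => -[|[|[|//]]] ?; rewrite /pt/= ?toCN2 ?toCN1.
  + by rewrite subrr !mul0r.
  + by rewrite addNr mulr0 mul0r.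
  + by rewrite -[toC 1]/(1 : C) subrr mulr0.
Qed.

Lemma Ku0 : ~ fiber curveS 1 (u0 R).
Proof.
move=> K; have [i /(congr1 (@complex.Im R))/=] := (curveS_fiber1 _).1 K; lra.
Qed.

Lemma segment_path (a b : C) : discD a -> discD b ->
  complex.Im a < 0 -> complex.Im b < 0 ->
  is_path (D `\` fiber curveS 1) a b (segment a b).
Proof.
move=> Da Db a0 b0; split.
- exact/continuous_subspaceT/continuous_segment.
- move=> t; rewrite /= in_itv/= => /andP[t0 t1].
  have -> : segment a b t = (1 - t) *: a + t *: b.
    by rewrite /segment scalerBr scalerBl scale1r addrA addrAC.
  split.
  + rewrite /discD/= (le_trans (ler_normD _ _))// !normcZ.
    rewrite !ger0_norm ?subr_ge0//.
    move: Da Db; rewrite /discD/= => Da Db; nra.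
  + move=> K; have [i /(congr1 (@complex.Im R))] := (curveS_fiber1 _).1 K.
    by case: (a) (b) a0 b0 => [? ?] [? ?] /= a0 b0; nra.
- by rewrite /segment scale0r addr0.
- by rewrite /segment scale1r subrKC.
Qed.

Lemma circle_path (p a : C) (r : R) : 0 < r -> `|a - p| = r -> `|p| + r <= 4 ->
  (forall i, p = toC (pt i) \/ r < `|toC (pt i) - p|) ->
  is_path (D `\` fiber curveS 1) a a (rotation p a (2 * pi)).
Proof.
move=> r0 apr pr pK; split.
- exact/continuous_subspaceT/continuous_rotation.
- move=> t _; have nr : `|rotation p a (2 * pi) t - p| = r.
    by rewrite /rotation addrC addKr normCM norm_cis mul1r.
  split.
  + rewrite /discD/= -(subrK p (rotation p a (2 * pi) t)).
    by rewrite (le_trans (ler_normD _ _))// nr addrC.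
  + move=> K; have [i iE] := (curveS_fiber1 _).1 K.
    move: nr; rewrite iE; case: (pK i) => [->|]; last by move=> + e; rewrite e ltxx.
    by rewrite subrr normr0 => e; move: r0; rewrite -e ltxx.
- by rewrite /rotation mulr0 /cis cos0 sin0 mul1r subrKC.
- by rewrite /rotation mulr1 mulr_natl /cis cos2pi sin2pi mul1r subrKC.
Qed.

Lemma pt_sep i j : pt i = pt j \/ 1 <= `|pt i - pt j|.
Proof.
case: i j => -[|[|[|//]]] ? [[|[|[|//]]] ?]; rewrite /pt /=;
  try (by left); right; rewrite ler_normr; apply/orP; solve [left; lra|right; lra].
Qed.

Lemma lasso_path (r : R) (i : 'I_3) : 0 < r < 1 ->
  is_path (D `\` fiber curveS 1) (u0 R) (u0 R) (lasso (u0 R) (toC (pt i)) r).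
Proof.
move=> /andP[r0 r1]; rewrite /lasso; set p := toC (pt i).
set a := (X in concat (segment _ X)).
have d0 : 0 < `|u0 R - p|.
  rewrite normr_gt0; apply/eqP => /(congr1 (@complex.Im R))/=; lra.
have apr : `|a - p| = r.
  rewrite /a addrC addKr normcZ ger0_norm; last by rewrite divr_ge0// ltW.
  by rewrite divfK// gt_eqF.
have p2 : `|p| <= 2 by rewrite norm_toC pt_norm.
have Da : discD a.
  by rewrite /discD/= -(subrK p a) (le_trans (ler_normD _ _))// apr; lra.
have Du : discD (u0 R) by rewrite /discD/= bdD_u0.
have a0 : complex.Im a < 0.
  have : 0 < r / `|u0 R - p| by rewrite divr_gt0.
  by rewrite /a /=; lra.
have uL0 : complex.Im (u0 R) < 0 by rewrite /=; lra.
apply: (is_path_concat (y := a)); first exact: segment_path.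
apply: (is_path_concat (y := a)); last exact: segment_path.
apply: circle_path apr _ _ => //; first lra.
move=> j; have [->|ij] := pt_sep j i; first by left.
right; rewrite (_ : toC (pt j) - p = toC (pt j - pt i)); last first.
  by apply/eqP; rewrite eq_complex/= subr0 !eqxx.
by rewrite norm_toC (lt_le_trans r1).
Qed.

Definition gbase (r : R) (hr : 0 < r < 1) (i : 'I_3) : pi1 R (base Ku0) :=
  pi1_class (@Loop _ _ _ (base Ku0) _ (lasso_path i hr)).

(* -1 and 1 rotate about 0 by the angle 4 pi while -2 is fixed, then -2 rotates
   about 0 by the angle 2 pi while -1 and 1 are fixed *)
Definition twist_motion (i : 'I_3) : R -> C :=
  let p := toC (pt i) in
  if i == 0 then concat (cst p) (rotation 0 p (2 * pi))
  else concat (rotation 0 p (4 * pi)) (cst p).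

End curve.

(* Main.v *)
Require Import Defs.
From mathcomp Require Import all_boot all_order all_algebra.
From mathcomp Require Import all_classical all_reals all_analysis.
From mathcomp Require Import complex ring lra.

(** Over x = cis (2 pi t) the curve has the points -2x, -x^2 and x^2: these
    are -2, -1 and 1 turned about 0 by the angles 2 pi t, 4 pi t and 4 pi t.
    The angle depends only on the modulus of the point, so the motion is
    realized by twists, the maps z |-> z * cis (t * a(|z|^2)) where a is a
    polynomial with a(1) = 4 pi, a(4) = 2 pi and a(16) = 0. If a is split as
    inner + outer, with inner vanishing at 4 and outer at 1, then performing
    the inner twist first and the outer twist afterwards realizes the motion
    in which -1 and 1 make their two full twists before -2 makes its
    revolution. Both isotopies end at the same diffeomorphism phi, so both
    motions induce the class of phi ([local_monodromy_braid],
    [twist_motion_braid]). That a motion determines its braid is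
    [braid_class_eq]: two realizations Phi and Phi' of one motion give the
    isotopy Phi_1 o Phi_s^-1 o Phi'_s from Phi_1 to Phi'_1, which never moves
    a point into K.

    For the relations, note that the punctures leave four gaps on the real
    axis, numbered 0 to 3 from left to right. Up to homotopy there is one path
    e_k from -4i to 4i that passes from the lower to the upper half disc
    through the k-th gap, because a half disc together with one open gap is
    convex ([crosses_uniq]). The loop x_i goes up through the gap to the right of its
    puncture and down through the gap to the left, so that the generators are
    x_1 = e_1 e_0^-1, x_2 = e_2 e_1^-1, x_3 = e_3 e_2^-1 ([cl_lasso]).

    The twist phi fixes the circles |z| = 4 and |z| = 3/2 pointwise; the second
    one separates -1 and 1 from -2, and a is chosen with a(9/4) = 2 pi for that
    purpose. Representatives of the e_k are made of arcs of these circles and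
    of pieces of the imaginary axis. A radial piece is spiralled by phi; since
    the spiralling can be undone while the ends of the piece slide along
    circles, its image is the piece itself with full circles inserted at its
    ends ([cl_twist_ray]). With d = e_3 e_0^-1 = x_3 x_2 x_1 and
    w = d (x_3 x_2) this yields

      phi(x_1) = d x_1 d^-1,  phi(x_2) = w x_2 w^-1,  phi(x_3) = w x_3 w^-1.

    The induced relations thus say that x_1 commutes with d, and x_2 and x_3
    with w. As d = (x_3 x_2) x_1, the first one says that x_1 commutes with
    x_3 x_2; then w commutes with x_3 x_2, so that the last two are equivalent
    to each other, and to w = x_2 w x_2^-1 = x_2 x_3 x_2 x_1 x_3
    ([twist_relations]). *)

Set Implicit Arguments.
Unset Strict Implicit.
Unset Printing Implicit Defensive.

Import Order.TTheory GRing.Theory Num.Theory numFieldNormedType.Exports.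

Local Open Scope classical_set_scope.
Local Open Scope ring_scope.

Local Notation rev_path := Defs.rev_path.

(** * Normal closures of commutation relations *)

Section commutation_modulo.
Local Open Scope group_scope.
Variables (G : groupType) (N : set G).
Hypothesis nN : normal_subgroup N.

(** The commutator lies in N: the images in the quotient by N commute. *)
Definition commute_mod (g h : G) := N (g * h * (h * g)^-1).

Let N1 : N 1. Proof. by case: nN. Qed.
Let NM g h : N g -> N h -> N (g * h). Proof. by case: nN => _ + _ _; apply. Qed.
Let NV g : N g -> N g^-1. Proof. by case: nN => _ _ + _; apply. Qed.
Let NJ g h : N g -> N (h * g * h^-1).
Proof.
by case: nN => _ _ _ + Ng => /(_ g h^-1 Ng); rewrite conjgE invgK mulgA.
Qed.

Lemma commute_mod_refl g : commute_mod g g.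
Proof. by rewrite /commute_mod mulgV. Qed.

Lemma commute_mod_sym g h : commute_mod g h -> commute_mod h g.
Proof. by move=> /NV; rewrite invgM invgK. Qed.

Lemma commute_modM g h k :
  commute_mod g h -> commute_mod g k -> commute_mod g (h * k).
Proof.
move=> gh /(@NJ _ h) gk; have := NM gh gk; rewrite /commute_mod.
by rewrite !invgM !mulgA !mulgVK.
Qed.

Lemma commute_modV g h : commute_mod g h -> commute_mod g h^-1.
Proof.
move=> /NV/(@NJ _ h^-1); rewrite /commute_mod !invgM !invgK !mulgA.
by rewrite mulVg mul1g.
Qed.

Lemma commute_modMl g h k :
  commute_mod g k -> commute_mod h k -> commute_mod (g * h) k.
Proof.
by move=> gk hk; apply/commute_mod_sym/commute_modM; exact: commute_mod_sym.
Qed.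

End commutation_modulo.

Section closures.
Local Open Scope group_scope.
Variable G : groupType.

Lemma normal_closure_subgroup (X : set G) : normal_subgroup (normal_closure X).
Proof.
split.
- by move=> N [[]].
- by move=> g h Xg Xh N NX; have [[_ + _ _] _] := NX; apply; [apply: Xg|apply: Xh].
- by move=> g Xg N NX; have [[_ _ + _] _] := NX; apply; apply: Xg.
- by move=> g h Xg N NX; have [[_ _ _ +] _] := NX; apply; apply: Xg.
Qed.

Lemma sub_normal_closure (X : set G) : X `<=` normal_closure X.
Proof. by move=> g Xg N [_]; apply. Qed.

Lemma normal_closure_eq (X Y : set G) :
  X `<=` normal_closure Y -> Y `<=` normal_closure X ->
  normal_closure X = normal_closure Y.
Proof.
move=> XY YX; apply/seteqP; split=> g.
- by apply; split; [exact: normal_closure_subgroup|].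
- by apply; split; [exact: normal_closure_subgroup|].
Qed.

(** In the quotient by either normal closure, x1 commutes with x3 x2 (for
    d = (x3 x2) x1 and x1 commutes with itself), hence w = (x3 x2) x1 (x3 x2)
    commutes with x3 x2; so w commutes with x3 as soon as it does with x2. *)
Lemma twist_relations (x1 x2 x3 : G) (y : 'I_3 -> G * G) :
  let d := x3 * x2 * x1 in
  let w := x3 * x2 * x1 * x3 * x2 in
  y ord0 = (d * x1 * d^-1, x1) ->
  y 1%R = (w * x2 * w^-1, x2) ->
  y 2%R = (w * x3 * w^-1, x3) ->
  relation_closure [set y j | j in [set: 'I_3]] =
  relation_closure [set (x1 * x3 * x2, x3 * x2 * x1);
                        (w, x2 * x3 * x2 * x1 * x3)].
Proof.
move=> d w y0 y1 y2.
have conjE (g h : G) : g * h * g^-1 * h^-1 = g * h * (h * g)^-1.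
  by rewrite invgM mulgA.
apply: normal_closure_eq => _ [e + <-].
- have := @sub_normal_closure [set e.1 * e.2^-1 | e in
    [set (x1 * x3 * x2, x3 * x2 * x1); (w, x2 * x3 * x2 * x1 * x3)]].
  set N := normal_closure _ => YN.
  have nN : normal_subgroup N by exact: normal_closure_subgroup.
  rewrite -/N; clearbody N.
  have c1 : commute_mod N (x3 * x2) x1.
    apply: (commute_mod_sym nN); apply: YN.
    by exists (x1 * x3 * x2, x3 * x2 * x1); [left|rewrite /= !mulgA].
  have c2 : commute_mod N w x2.
    apply: YN.
    exists (w, x2 * x3 * x2 * x1 * x3); [by right|rewrite /= /w !invgM !mulgA].
    by rewrite mulgK.
  have c3 : commute_mod N w x3.
    (* x3 = (x3 x2) x2^-1, and both factors commute with w. *)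
    rewrite -(mulgK x2 x3); apply: (commute_modM nN); last first.
      exact: (commute_modV nN).
    rewrite (_ : w = x3 * x2 * x1 * (x3 * x2)); last by rewrite !mulgA.
    apply: (commute_modMl nN); last exact: (commute_mod_refl nN).
    apply/(commute_mod_sym nN)/(commute_modM nN) => //.
    exact: (commute_mod_refl nN).
  move=> [j _ <-]; case: (fintype.unliftP ord0 j) => [k ->|->]; last first.
    rewrite y0 /= conjE; apply: (commute_modMl nN c1).
    exact: (commute_mod_refl nN).
  have [->|->] : lift ord0 k = 1%R \/ lift ord0 k = 2%R.
    by case: k => -[|[|//]] ?; [left|right]; apply/val_inj.
  + by rewrite y1 /= conjE.
  + by rewrite y2 /= conjE.
- have := @sub_normal_closure [set e.1 * e.2^-1 | e in
    [set y j | j in [set: 'I_3]]].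
  set N := normal_closure _ => YN.
  have nN : normal_subgroup N by exact: normal_closure_subgroup.
  rewrite -/N; clearbody N.
  have yN j : N ((y j).1 * (y j).2^-1).
    by apply: YN; exists (y j) => //; exists j.
  have := yN ord0; rewrite y0 /= conjE => c1.
  have := yN 1%R; rewrite y1 /= conjE => c2.
  move=> [] -> /=.
    rewrite -(mulgA x1); apply: (commute_mod_sym nN).
    rewrite -[x3 * x2](mulgK x1); apply: (commute_modMl nN c1).
    apply/(commute_mod_sym nN)/(commute_modV nN).
    exact: (commute_mod_refl nN).
  suff -> : w * (x2 * x3 * x2 * x1 * x3)^-1 = w * x2 * (x2 * w)^-1 by [].
  by rewrite /w !invgM !mulgA mulgK.
Qed.

End closures.

(** * Homotopies from convexity, and the classes of open paths *)

Section convex_homotopy.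
Variable R : realType.
Local Notation I := (`[0, 1]%classic : set R).

Definition segment_closed (V : normedModType R) (B : set V) :=
  forall x y s, B x -> B y -> I s -> B ((1 - s) *: x + s *: y).

(** The straight-line homotopy in B, transported by c, which will be the
    identity, a polar map or a homotopy square. *)
Lemma homotopic_convex (V : normedModType R) (T : topologicalType) (A : set T)
    (B : set V) (c : V -> T) x y (f g : R -> V) :
  segment_closed B -> {within B, continuous c} ->
  (forall z, B z -> A (c z)) ->
  is_path B x y f -> is_path B x y g -> homotopic A (c \o f) (c \o g).
Proof.
move=> cB cc BA [cf Bf f0 f1] [cg Bg g0 g1].
exists (fun st => c ((1 - st.1) *: f st.2 + st.1 *: g st.2)); split.
- apply: (@within_comp (R * R)%type V T _ B
    (fun st => (1 - st.1) *: f st.2 + st.1 *: g st.2) c) => //; last first.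
    by move=> [s t] [/= Is It]; apply: cB => //; [exact: Bf|exact: Bg].
  have snd_comp (h : R -> V) : {within I, continuous h} ->
      {within I `*` I, continuous (h \o snd)}.
    move=> ch; apply: (@within_comp (R * R)%type R V _ I) => //; last first.
      by move=> [s t] [].
    by apply: continuous_subspaceT; exact: continuous_snd.
  have /subspace_continuousP cf' := snd_comp _ cf.
  have /subspace_continuousP cg' := snd_comp _ cg.
  apply/subspace_continuousP => st Ist.
  have cfst : fst @ within (I `*` I) (nbhs st) --> st.1.
    by apply: cvg_within_filter; exact: (@continuous_fst R R st).
  apply: cvgD; apply: cvgZ.
  + by apply: cvgB; [exact: cvg_cst|exact: cfst].
  + exact: cf'.
  + exact: cfst.
  + exact: cg'.
- by move=> s t Is It; apply/BA/cB; [exact: Bf|exact: Bg|].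
- by move=> t _ /=; rewrite subr0 subrr !scale1r !scale0r addr0 add0r.
- by move=> s _ /=; rewrite f0 f1 g0 g1 -!scalerDl !subrK !scale1r.
Qed.

Lemma segment_closed_itv : segment_closed (I : set R^o).
Proof.
move=> x y s; rewrite /= !in_itv/= => /andP[x0 x1] /andP[y0 y1] /andP[s0 s1].
by rewrite /GRing.scale/=; apply/andP; split; nra.
Qed.

(** The two ways round the boundary of the unit square are homotopic in the
    square, which is convex. *)
Lemma homotopic_square (T : topologicalType) (A : set T) (H : R * R -> T) :
  {within I `*` I, continuous H} ->
  (forall s t, I s -> I t -> A (H (s, t))) ->
  homotopic A (concat (fun t => H (0, t)) (fun s => H (s, 1)))
              (concat (fun s => H (s, 0)) (fun t => H (1, t))).
Proof.
move=> cH AH.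
have pathP (h : R -> R^o * R^o) : continuous h ->
    (forall t, I t -> (I `*` I) (h t)) -> is_path (I `*` I) (h 0) (h 1) h.
  by move=> ch Ih; split => //; exact: continuous_subspaceT.
have cst_id (a : R) : continuous (fun t : R => (a, t) : R^o * R^o).
  by apply: (@continuous_pair R R R); move=> ?; [exact: cvg_cst|exact: cvg_id].
have id_cst (a : R) : continuous (fun t : R => (t, a) : R^o * R^o).
  by apply: (@continuous_pair R R R); move=> ?; [exact: cvg_id|exact: cvg_cst].
have I0 := I0 R; have I1 := I1 R.
pose l1 : R -> R^o * R^o := concat (fun t => (0, t)) (fun s => (s, 1)).
pose l2 : R -> R^o * R^o := concat (fun s => (s, 0)) (fun t => (1, t)).
have p1 : is_path (I `*` I) ((0, 0) : R^o * R^o) (1, 1) l1.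
  exact: is_path_concat (pathP _ (cst_id 0) _) (pathP _ (id_cst 1) _).
have p2 : is_path (I `*` I) ((0, 0) : R^o * R^o) (1, 1) l2.
  exact: is_path_concat (pathP _ (id_cst 0) _) (pathP _ (cst_id 1) _).
have cI : segment_closed (I `*` I : set (R^o * R^o)%type).
  move=> [x1 x2] [y1 y2] s [/= a b] [/= a' b'] Is.
  by split; apply: segment_closed_itv.
have AH' (z : R^o * R^o) : (I `*` I) z -> A (H z).
  by case: z => s t [/= Is It]; exact: AH.
have := homotopic_convex cI cH AH' p1 p2.
rewrite (_ : H \o l1 = concat (fun t => H (0, t)) (fun s => H (s, 1))); last first.
  by apply/funext => t; rewrite /l1 /concat /=; case: ifP.
rewrite (_ : H \o l2 = concat (fun s => H (s, 0)) (fun t => H (1, t)))//.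
by apply/funext => t; rewrite /l2 /concat /=; case: ifP.
Qed.

End convex_homotopy.

Section transport.
Local Open Scope group_scope.
Variables (R : realType) (T : topologicalType) (A : set T) (x0 : A).
Local Notation b := (\val x0).
Implicit Types f g h : R -> T.

Local Hint Resolve is_path_concat is_path_rev : core.

Definition reach (x : T) := exists f : R -> T, is_path A b x f.

Lemma reach_path x y f : reach x -> is_path A x y f -> reach y.
Proof. by move=> [g gP] fP; exists (concat g f); exact: is_path_concat fP. Qed.

Lemma reach_base : reach b.
Proof. by exists (cst b); apply: is_path_cst; exact: base_in. Qed.

(** A chosen path from the base point to x; it is constant at the base point
    itself so that a loop keeps its own class. *)
Definition tether (x : T) : R -> T :=
  if `[< x = b >] then cst b else xget (cst b) [set f | is_path A b x f].

Lemma tetherP x : reach x -> is_path A b x (tether x).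
Proof.
rewrite /tether => rx; case: asboolP => [->|_].
  by apply: is_path_cst; exact: base_in.
by have [f fP] := rx; exact: (xgetPex (cst b) (ex_intro _ f fP)).
Qed.

Definition tethered f : R -> T :=
  concat (tether (f 0%R)) (concat f (rev_path (tether (f 1%R)))).

(** A morphism from the groupoid of paths in A to the fundamental group: the
    path f from x to y is closed up by the tethers of x and y. Open paths can
    thus be multiplied, inverted and cancelled inside one group. *)
Definition path_class f : pi1 R x0 :=
  if pselect (is_path A b b (tethered f)) is left P then pi1_class (Loop P)
  else 1.

Lemma tethered_path x y f : reach x -> is_path A x y f ->
  is_path A b b (tethered f).
Proof.
move=> rx fP; have ry := reach_path rx fP; have [_ _ f0 f1] := fP.
rewrite /tethered f0 f1; have := tetherP rx; have := tetherP ry; eauto.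
Qed.

Lemma path_classE x y f (rx : reach x) (fP : is_path A x y f) :
  path_class f = pi1_class (Loop (tethered_path rx fP)).
Proof.
rewrite /path_class; case: pselect => [P|/(_ (tethered_path rx fP))//].
by congr (pi1_class (Loop _)); exact: Prop_irrelevance.
Qed.

Lemma path_class_homotopic x y f g : reach x ->
  is_path A x y f -> is_path A x y g -> homotopic A f g -> path_class f = path_class g.
Proof.
move=> rx fP gP fg; rewrite (path_classE rx fP) (path_classE rx gP); apply/pi1_classP => /=.
have [_ _ f0 f1] := fP; have [_ _ g0 g1] := gP.
have dx := tetherP rx; have dy := tetherP (reach_path rx fP).
rewrite /tethered f0 f1 g0 g1.
apply: (homotopic_concat (x := b) (y := x) (z := b)); eauto.
  exact: homotopic_refl dx.
apply: (homotopic_concat (x := x) (y := y) (z := b)); eauto.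
exact: homotopic_refl (is_path_rev dy).
Qed.

Lemma path_class_loop f (fP : is_path A b b f) : path_class f = pi1_class (Loop fP).
Proof.
rewrite (path_classE reach_base fP); apply/pi1_classP => /=.
have [_ _ f0 f1] := fP.
have -> : tethered f = concat (cst b) (concat f (cst b)).
  by rewrite /tethered f0 f1 /tether; case: asboolP.
have bP : is_path A b b (cst b : R -> T) by apply: is_path_cst; exact: base_in.
apply: (@homotopic_trans _ _ _ b b _ (concat f (cst b))); eauto.
  by apply: concat1p; eauto.
exact: concatp1 fP.
Qed.

(** The tether of the middle point is run through forth and back, and cancels. *)
Lemma path_class_concat x y z f g : reach x -> is_path A x y f -> is_path A y z g ->
  path_class (concat f g) = path_class f * path_class g.
Proof.
move=> rx fP gP; have ry := reach_path rx fP.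
have fgP := is_path_concat fP gP.
rewrite (path_classE rx fgP) (path_classE rx fP) (path_classE ry gP) pi1_classM.
apply/pi1_classP => /=; apply: (@homotopic_sym _ _ _ b b).
- exact: is_path_concat (tethered_path rx fP) (tethered_path ry gP).
- exact: tethered_path rx fgP.
have dx := tetherP rx; have dy := tetherP ry.
have dz := tetherP (reach_path ry gP).
have [_ _ f0 f1] := fP; have [_ _ g0 g1] := gP; have [_ _ fg0 fg1] := fgP.
rewrite /tethered f0 f1 g0 g1 fg0 fg1.
move: (tether x) (tether y) (tether z) dx dy dz => dx dy dz dxP dyP dzP.
have dyV := is_path_rev dyP; have dzV := is_path_rev dzP.
apply: (@homotopic_trans _ _ _ b b _
  (concat dx (concat (concat f (rev_path dy)) (concat dy (concat g (rev_path dz)))))).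
- by eauto 8.
- by eauto 8.
- by eauto 8.
- apply: (@homotopic_sym _ _ _ b b); [by eauto 8|by eauto 8|].
  by apply: (@concatA _ _ _ b x b b); eauto.
apply: (@homotopic_concat _ _ _ b x b); [by eauto|by eauto|by eauto 8|by eauto 8| |].
  exact: homotopic_refl dxP.
apply: (@homotopic_trans _ _ _ x b _
  (concat f (concat (rev_path dy) (concat dy (concat g (rev_path dz)))))).
- by eauto 8.
- by eauto 8.
- by eauto 8.
- apply: (@homotopic_sym _ _ _ x b); [by eauto 8|by eauto 8|].
  by apply: (@concatA _ _ _ x y b b); eauto.
apply: (@homotopic_trans _ _ _ x b _ (concat f (concat g (rev_path dz)))).
- by eauto 8.
- by eauto 8.
- by eauto 8.
- apply: (@homotopic_concat _ _ _ x y b); [by eauto|by eauto|by eauto 8|by eauto 8| |].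
    exact: homotopic_refl fP.
  have yP : is_path A y y (cst y : R -> T).
    by apply: is_path_cst; case: gP => _ + <- _; apply; exact: I0.
  apply: (@homotopic_trans _ _ _ y b _
    (concat (concat (rev_path dy) dy) (concat g (rev_path dz)))).
  + by eauto 8.
  + by eauto 8.
  + by eauto 8.
  + by apply: (@concatA _ _ _ y b y b); eauto.
  apply: (@homotopic_trans _ _ _ y b _
    (concat (cst y) (concat g (rev_path dz)))).
  + by eauto 8.
  + by eauto 8.
  + by eauto 8.
  + apply: (@homotopic_concat _ _ _ y y b); [by eauto|by eauto|by eauto|by eauto| |].
      exact: concatVp dyP.
    by apply: (@homotopic_refl _ _ _ y b); eauto.
  + by apply: (@concat1p _ _ _ y b); eauto.
by apply: (@concatA _ _ _ x y z b); eauto.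
Qed.

Lemma path_class_cst x : reach x -> path_class (cst x) = 1.
Proof.
move=> rx; have [g gP] := rx.
have xP : is_path A x x (cst x : R -> T).
  by apply: is_path_cst; case: gP => _ + _ <-; apply; exact: I1.
apply: (mulgI (path_class (cst x))); rewrite mulg1 -(path_class_concat rx xP xP).
by apply: (path_class_homotopic (x := x) (y := x)); eauto; exact: concat1p xP.
Qed.

Lemma path_class_rev x y f : reach x -> is_path A x y f -> path_class (rev_path f) = (path_class f)^-1.
Proof.
move=> rx fP; apply: (mulgI (path_class f)).
rewrite mulgV -(path_class_concat rx fP (is_path_rev fP)) -(path_class_cst rx).
apply: (path_class_homotopic (x := x) (y := x)) => //; eauto.
  by apply: is_path_cst; case: fP => _ + <- _; apply; exact: I0.
exact: concatpV fP.
Qed.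

End transport.

(** * The plane, and a class of smooth functions *)

Section plane_lemmas.
Variable R : realType.
Local Notation C := (Rcomplex R).
Implicit Types z w : C.

Lemma complex_scaleE (a b : R) :
  Complex a b = a *: (1 : C) + b *: (Complex 0 1 : C) :> C.
Proof. by apply/eqP; rewrite eq_complex/=; apply/andP; split; apply/eqP; ring. Qed.

Lemma norm_complexE z : `|z| = Num.sqrt (complex.Re z ^+ 2 + complex.Im z ^+ 2).
Proof. by case: z. Qed.

Lemma ler_norm_Re z : `|complex.Re z| <= `|z|.
Proof.
by rewrite norm_complexE -sqrtr_sqr ler_wsqrtr// lerDl sqr_ge0.
Qed.

Lemma ler_norm_Im z : `|complex.Im z| <= `|z|.
Proof.
by rewrite norm_complexE -sqrtr_sqr ler_wsqrtr// lerDr sqr_ge0.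
Qed.

Lemma continuous_Re : continuous (@complex.Re R : C -> R).
Proof.
move=> z; apply/(@cvgrPdist_lt _ _ _ (nbhs z)) => e e0; near=> w.
rewrite -(raddfB (@complex.Re R : C -> R)) (le_lt_trans (ler_norm_Re _))//.
Unshelve. all: by end_near. Qed.

Lemma continuous_Im : continuous (@complex.Im R : C -> R).
Proof.
move=> z; apply/(@cvgrPdist_lt _ _ _ (nbhs z)) => e e0; near=> w.
rewrite -(raddfB (@complex.Im R : C -> R)) (le_lt_trans (ler_norm_Im _))//.
Unshelve. all: by end_near. Qed.

Lemma continuous_complex (X : topologicalType) (f g : X -> R) :
  continuous f -> continuous g ->
  continuous (fun x => Complex (f x) (g x) : C).
Proof.
move=> cf cg; under eq_fun do rewrite complex_scaleE.
move=> x; apply: cvgD; apply: cvgZr_tmp; [exact: cf|exact: cg].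
Qed.

Definition sqnorm z : R := complex.Re z ^+ 2 + complex.Im z ^+ 2.

Lemma norm_sqnorm z : `|z| = Num.sqrt (sqnorm z).
Proof. exact: norm_complexE. Qed.

Lemma sqnormE z : sqnorm z = `|z| ^+ 2.
Proof. by rewrite norm_sqnorm sqr_sqrtr// addr_ge0// sqr_ge0. Qed.

Lemma cisD (s t : R) : cis (s + t) = cis s * cis t :> C.
Proof.
by apply/eqP; rewrite eq_complex/= cosD sinD; apply/andP; split; apply/eqP; ring.
Qed.

Lemma cis0 : cis 0 = 1 :> C.
Proof. by rewrite /cis cos0 sin0. Qed.

Lemma cisD2pi (t : R) : cis (t + 2 * pi) = cis t :> C.
Proof. by rewrite /cis mulr_natl cosD2pi sinD2pi. Qed.

Lemma cis2pi : cis (2 * pi) = 1 :> C.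
Proof. by rewrite -[2 * pi]add0r cisD2pi cis0. Qed.

End plane_lemmas.

(** Smoothness on the plane is an infinite iteration of directional
    derivatives. It is proved for the real functions of Re z and Im z built
    from constants by sums, products, cosine and sine: the directional
    derivatives of such a function are again of this form, and expressions
    make this closure an induction. *)
Section trig_expr.
Variable R : realType.
Local Notation C := (Rcomplex R).

Inductive trig_expr :=
| TCst of R | TRe | TIm
| TAdd of trig_expr & trig_expr | TMul of trig_expr & trig_expr
| TCos of trig_expr | TSin of trig_expr.

Fixpoint teval (e : trig_expr) : C -> R :=
  match e with
  | TCst a => fun=> a
  | TRe => @complex.Re R
  | TIm => @complex.Im R
  | TAdd e1 e2 => teval e1 + teval e2
  | TMul e1 e2 => teval e1 * teval e2
  | TCos e => cos \o teval e
  | TSin e => sin \o teval e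
  end.

Fixpoint tdir (v : C) (e : trig_expr) : trig_expr :=
  match e with
  | TCst a => TCst 0
  | TRe => TCst (complex.Re v)
  | TIm => TCst (complex.Im v)
  | TAdd e1 e2 => TAdd (tdir v e1) (tdir v e2)
  | TMul e1 e2 => TAdd (TMul e1 (tdir v e2)) (TMul e2 (tdir v e1))
  | TCos e => TMul (TMul (TCst (-1)) (TSin e)) (tdir v e)
  | TSin e => TMul (TCos e) (tdir v e)
  end.

Lemma differentiable_teval e z : differentiable (teval e) z.
Proof.
elim: e => [a|||e1 h1 e2 h2|e1 h1 e2 h2|e h|e h] /=.
- exact: differentiable_cst.
- exact/linear_differentiable/continuous_Re.
- exact/linear_differentiable/continuous_Im.
- exact: differentiableD.
- exact: differentiableM.
- by apply: differentiable_comp => //; exact/derivable1_diffP/derivable_cos.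
- by apply: differentiable_comp => //; exact/derivable1_diffP/derivable_sin.
Qed.

Lemma diff_teval e v z : 'd (teval e) z v = teval (tdir v e) z.
Proof.
have dcos x : differentiable (@cos R) x by exact/derivable1_diffP/derivable_cos.
have dsin x : differentiable (@sin R) x by exact/derivable1_diffP/derivable_sin.
have dcosE x h : 'd (@cos R) x h = h * - sin x.
  by rewrite diff1E// derive1E derive_val.
have dsinE x h : 'd (@sin R) x h = h * cos x.
  by rewrite diff1E// derive1E derive_val.
elim: e => [a|||e1 h1 e2 h2|e1 h1 e2 h2|e h|e h] /=.
- by rewrite diff_cst.
- by rewrite (@diff_lin _ _ _ (@complex.Re R : C -> R))//; exact: continuous_Re.
- by rewrite (@diff_lin _ _ _ (@complex.Im R : C -> R))//; exact: continuous_Im.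
- rewrite (diffD (differentiable_teval _ _) (differentiable_teval _ _)).
  exact: (congr2 +%R h1 h2).
- rewrite (diffM (differentiable_teval _ _) (differentiable_teval _ _)).
  exact: (congr2 +%R (congr1 ( *%R _) h2) (congr1 ( *%R _) h1)).
- rewrite (diff_comp (differentiable_teval _ _) (dcos _)).
  by rewrite [LHS]dcosE h mulrC mulN1r.
- rewrite (diff_comp (differentiable_teval _ _) (dsin _)).
  by rewrite [LHS]dsinE h mulrC.
Qed.

(** A map of the plane is smooth when its real and imaginary parts are given by
    expressions. *)
Lemma class_C_trig k (e1 e2 : trig_expr) :
  class_C k (fun z => teval e1 z *: (1 : C) + teval e2 z *: (Complex 0 1 : C)).
Proof.
have dF e (w : C) z : differentiable (fun z => teval e z *: w) z.
  exact/differentiableZl/differentiable_teval.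
elim: k e1 e2 => [|k IH] e1 e2 /=.
  by move=> z; apply: differentiable_continuous; exact: differentiableD.
split=> [z|v]; first exact: differentiableD.
have := IH (tdir v e1) (tdir v e2); congr (class_C k _); apply/funext => z.
rewrite -!diff_teval [in RHS]diffD//= diffZl; last exact: differentiable_teval.
by rewrite diffZl//; exact: differentiable_teval.
Qed.

End trig_expr.

(** * A motion determines its braid *)

Lemma within_pair (X Y Z : topologicalType) (A : set X) (f : X -> Y) (g : X -> Z) :
  {within A, continuous f} -> {within A, continuous g} ->
  {within A, continuous (fun x => (f x, g x))}.
Proof.
move=> /subspace_continuousP cf /subspace_continuousP cg.
by apply/subspace_continuousP => x Ax; apply: cvg_pair; [exact: cf|exact: cg].
Qed.

Section isotopy_uniqueness.
Variable R : realType.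
Local Notation C := (Rcomplex R).
Local Notation D := (@discD R).
Local Notation I := (`[0, 1]%classic : set R).
Variables (K : set C) (Ku0 : ~ K (u0 R)).

(** The loops f are moved by Phi_1 o Psi_s o Phi'_s where Psi_s inverts Phi_s.
    If a point z landed in K at time s, then Phi'_s z would be one of the
    points m_j(s) = Phi'_s (m_j(0)), hence z would be m_j(0), a point of K. *)
Lemma braid_class_eq n (m : 'I_n -> R -> C) (Phi Psi Phi' : R -> C -> C)
    (phi phi' : braid_diffeo K) :
  motion K m ->
  realizes m Phi -> (forall z, D z -> phi z = Phi 1 z) ->
  realizes m Phi' -> (forall z, D z -> phi' z = Phi' 1 z) ->
  {within I `*` D, continuous (fun tz => Psi tz.1 tz.2)} ->
  (forall t z, I t -> D z ->
    [/\ D (Psi t z), Psi t (Phi t z) = z & Phi t (Psi t z) = z]) ->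
  braid_class Ku0 phi' = braid_class Ku0 phi.
Proof.
move=> [_ mD _ m0 m1] [cPhi dPhi Phi0 PhiK] phiE [cPhi' dPhi' Phi'0 Phi'K] phi'E.
move=> cPsi PsiK.
have I0 := I0 R; have I1 := I1 R.
have Du : D (u0 R) by rewrite /discD/= bdD_u0.
have bu := bdD_u0 R.
have PhiD t z : I t -> D z -> D (Phi t z).
  by move=> /dPhi[[_ [? [_ + _ _ _]] _]]; apply.
have Phi'D t z : I t -> D z -> D (Phi' t z).
  by move=> /dPhi'[[_ [? [_ + _ _ _]] _]]; apply.
have Phi'_inj t : I t -> {in D &, injective (Phi' t)}.
  move=> /dPhi'[[_ [psi [_ _ _ + _]] _]] => psiK z w; rewrite !inE => Dz Dw e.
  by rewrite -(psiK _ Dz) e psiK.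
apply/eqmodP/asboolP/funext; elim/pi1_ind => f.
rewrite /braid_diffeo_pi1 !pi1_mapE; apply/pi1_classP.
apply: (@homotopic_sym _ _ _ (u0 R) (u0 R)); [exact: loopP|exact: loopP|].
have [cf Af f0 f1] := loopP f; rewrite /= in f0 f1.
have Df t : I t -> D (f t) by move=> /Af[].
exists (fun st => Phi 1 (Psi st.1 (Phi' st.1 (f st.2)))); split.
- have c1 : {within I `*` I, continuous (fun st : R * R => (st.1, f st.2))}.
    apply: (@within_pair (R * R)%type R C).
      exact/continuous_subspaceT/continuous_fst.
    apply: (@within_comp (R * R)%type R C _ I) => //; last by move=> -[s t] [].
    exact/continuous_subspaceT/continuous_snd.
  have c2 : {within I `*` D, continuous (fun tz : R * C => (tz.1, Phi' tz.1 tz.2))}.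
    apply: (@within_pair (R * C)%type R C) => //.
    exact/continuous_subspaceT/continuous_fst.
  have c4 : {within D, continuous (Phi 1)}.
    apply: (@within_comp C (R * C)%type C _ (I `*` D) (fun z => (1, z))
      (fun tz => Phi tz.1 tz.2)) => //.
    apply/continuous_subspaceT/(@continuous_pair C R C).
      by move=> z; exact: cst_continuous.
    by move=> z; exact: cvg_id.
  apply: (@within_comp (R * R)%type C C _ D
    (fun st => Psi st.1 (Phi' st.1 (f st.2))) (Phi 1)) => //; last first.
    move=> [s t] [/= Is It].
    by have [] := PsiK s (Phi' s (f t)) Is (Phi'D _ _ Is (Df _ It)).
  apply: (@within_comp (R * R)%type (R * C)%type C _ (I `*` D)
    (fun st => (st.1, Phi' st.1 (f st.2))) (fun tz => Psi tz.1 tz.2)) => //; last first.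
    by move=> [s t] [/= Is It]; split => //; exact/Phi'D/Df.
  apply: (@within_comp (R * R)%type (R * C)%type (R * C)%type _ (I `*` D)
    (fun st => (st.1, f st.2)) (fun tz => (tz.1, Phi' tz.1 tz.2))) => //.
  by move=> [s t] [/= Is It]; split => //; exact: Df.
- move=> s t Is It /=; have D1 := Phi'D _ _ Is (Df _ It).
  have [D2 _ PhiPsi] := PsiK s _ Is D1.
  split; first exact: PhiD.
  rewrite -{1}m1 => -[j _ jE]; have [_ Kf] := Af _ It; apply: Kf.
  have Kj : K (m j 0) by rewrite -m0; exists j.
  have Dj : D (m j 0) by exact: mD.
  suff -> : f t = m j 0 by [].
  apply: (Phi'_inj _ Is); rewrite ?inE//; first exact: Df.
  rewrite Phi'K// -(PhiK j s)// -PhiPsi; congr (Phi s _).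
  have [_ <- _] := PsiK 1 _ I1 D2; have [_ <- _] := PsiK 1 _ I1 Dj.
  by rewrite PhiK// jE.
- move=> t It; have Dt := Df _ It; split => /=.
    by rewrite Phi'0// phiE//; have [_ + _] := PsiK 0 _ I0 Dt; rewrite Phi0// => ->.
  by rewrite phi'E//; have [_ _ ->] := PsiK 1 _ I1 (Phi'D _ _ I1 Dt).
- move=> s Is /=; rewrite f0 f1.
  suff -> : Phi 1 (Psi s (Phi' s (u0 R))) = phi (u0 R) by [].
  rewrite (dPhi' _ Is).2// phiE//; have [_ + _] := PsiK s _ Is Du.
  by rewrite (dPhi _ Is).2// => ->.
Qed.

End isotopy_uniqueness.

(** * Twists *)

Section twist.
Variable R : realType.
Local Notation C := (Rcomplex R).
Local Notation D := (@discD R).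
Local Notation I := (`[0, 1]%classic : set R).

(** As a function of s = |z|^2, the angle by which the moduli 1, 2 and 4 are
    turned is 4 pi, 0, 0 for the inner twist and 0, 2 pi, 0 for the outer one.
    The last factor of [inner_angle] is fitted so that the two angles add up
    to 2 pi at s = 9/4. *)
Definition inner_angle (s : R) : R :=
  pi * (s - 4) * (s - 16) * (4 / 45 - 2 / 55 * (s - 1)).

Definition outer_angle (s : R) : R := - (pi / 18) * (s - 1) * (s - 16).

Definition twist_angle (u v s : R) : R := u * inner_angle s + v * outer_angle s.

Definition twist (u v : R) (z : C) : C := z * cis (twist_angle u v (sqnorm z)).

Lemma twist_angle1 u v : twist_angle u v 1 = u * (4 * pi).
Proof. by rewrite /twist_angle /inner_angle /outer_angle; field. Qed.

Lemma twist_angle4 u v : twist_angle u v 4 = v * (2 * pi).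
Proof. by rewrite /twist_angle /inner_angle /outer_angle; field. Qed.

Lemma twist_angle16 u v : twist_angle u v 16 = 0.
Proof. by rewrite /twist_angle /inner_angle /outer_angle; field. Qed.

Lemma twist_angle_mid : twist_angle 1 1 (9 / 4) = 2 * pi.
Proof. by rewrite /twist_angle /inner_angle /outer_angle; field. Qed.

Lemma norm_twist u v z : `|twist u v z| = `|z|.
Proof. by rewrite /twist Defs.normCM norm_cis mulr1. Qed.

Lemma sqnorm_twist u v z : sqnorm (twist u v z) = sqnorm z.
Proof. by rewrite !sqnormE norm_twist. Qed.

Lemma twist00 z : twist 0 0 z = z.
Proof. by rewrite /twist /twist_angle !mul0r addr0 cis0 mulr1. Qed.

Lemma twistD u v u' v' z : twist u v (twist u' v' z) = twist (u + u') (v + v') z.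
Proof.
rewrite {1}/twist sqnorm_twist /twist -mulrA -cisD; congr (z * cis _).
by rewrite /twist_angle; ring.
Qed.

Lemma twistK u v z : twist (- u) (- v) (twist u v z) = z.
Proof. by rewrite twistD !addNr twist00. Qed.

Lemma twistVK u v z : twist u v (twist (- u) (- v) z) = z.
Proof. by rewrite twistD !addrN twist00. Qed.

Lemma twist_bd u v z : bdD z -> twist u v z = z.
Proof.
rewrite /bdD/= => z4; rewrite /twist sqnormE z4.
by rewrite (_ : 4 ^+ 2 = 16) ?twist_angle16 ?cis0 ?mulr1//; ring.
Qed.

Lemma twist_disc u v z : D z -> D (twist u v z).
Proof. by rewrite /discD/= norm_twist. Qed.

Lemma continuous_twist_angle (X : topologicalType) (u v s : X -> R) :
  continuous u -> continuous v -> continuous s ->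
  continuous (fun x => twist_angle (u x) (v x) (s x)).
Proof.
move=> cu cv cs.
have csB (a : R) : continuous (fun x => s x - a).
  by move=> x; apply: cvgB; [exact: cs|exact: cvg_cst].
move=> x; apply: cvgD; apply: cvgM; [exact: cu| |exact: cv|].
  apply: cvgM; last first.
    apply: cvgB; first exact: cvg_cst.
    by apply: cvgM; [exact: cvg_cst|exact: csB].
  by apply: cvgM; [apply: cvgM; [exact: cvg_cst|exact: csB]|exact: csB].
by apply: cvgM; [apply: cvgM; [exact: cvg_cst|exact: csB]|exact: csB].
Qed.

Lemma continuous_twist (X : topologicalType) (u v : X -> R) (g : X -> C) :
  continuous u -> continuous v -> continuous g ->
  continuous (fun x => twist (u x) (v x) (g x)).
Proof.
move=> cu cv cg.
have cre := continuous_compT cg (@continuous_Re R).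
have cim := continuous_compT cg (@continuous_Im R).
have cs : continuous (fun x => sqnorm (g x)).
  by move=> x; apply: cvgD; rewrite expr2; apply: cvgM;
    solve [exact: cre|exact: cim].
have ca := continuous_twist_angle cu cv cs.
have cc := continuous_compT ca (@continuous_cos R).
have cn := continuous_compT ca (@continuous_sin R).
pose theta x := twist_angle (u x) (v x) (sqnorm (g x)).
rewrite (_ : (fun x => _) = fun x => Complex
    (complex.Re (g x) * cos (theta x) - complex.Im (g x) * sin (theta x))
    (complex.Re (g x) * sin (theta x) + complex.Im (g x) * cos (theta x))); last first.
  by apply/funext => x; rewrite /twist /cis /theta; case: (g x).
apply: continuous_complex => x.
- by apply: cvgB; apply: cvgM; solve [exact: cre|exact: cim|exact: cc|exact: cn].
- by apply: cvgD; apply: cvgM; solve [exact: cre|exact: cim|exact: cc|exact: cn].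
Qed.

Lemma smooth_twist u v : smooth_on D (twist u v).
Proof.
pose s : trig_expr R := TAdd (TMul (TRe R) (TRe R)) (TMul (TIm R) (TIm R)).
pose sB a := TAdd s (TCst (- a)).
pose inner := TMul (TMul (TMul (TCst pi) (sB 4)) (sB 16))
  (TAdd (TCst (4 / 45)) (TMul (TCst (- (2 / 55))) (sB 1))).
pose outer := TMul (TMul (TCst (- (pi / 18))) (sB 1)) (sB 16).
pose a := TAdd (TMul (TCst u) inner) (TMul (TCst v) outer).
pose re := TAdd (TMul (TRe R) (TCos a)) (TMul (TCst (-1)) (TMul (TIm R) (TSin a))).
pose im := TAdd (TMul (TRe R) (TSin a)) (TMul (TIm R) (TCos a)).
exists (fun z => teval re z *: (1 : C) + teval im z *: (Complex 0 1 : C)).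
  by move=> k; exact: class_C_trig.
move=> z _; rewrite -complex_scaleE.
have aE : teval a z = twist_angle u v (sqnorm z).
  rewrite /= !fctE /= /twist_angle /inner_angle /outer_angle /sqnorm.
  ring.
rewrite /twist -aE /cis; case: z {aE} => x y.
by apply/eqP; rewrite eq_complex /= mulN1r !eqxx.
Qed.

Lemma diffeo_twist u v : diffeoD (twist u v).
Proof.
split; first exact: smooth_twist.
exists (twist (- u) (- v)); split; first exact: smooth_twist.
- by move=> z; exact: twist_disc.
- by move=> z; exact: twist_disc.
- by move=> z _; exact: twistK.
- by move=> z _; exact: twistVK.
Qed.

Lemma sqnorm_toC a : sqnorm (toC a) = a ^+ 2 :> R.
Proof. by rewrite /sqnorm/= expr0n addr0. Qed.

Lemma twist_pt u v (i : 'I_3) : twist u v (toC (pt R i)) =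
  toC (pt R i) * cis (if i == 0 then v * (2 * pi) else u * (4 * pi)).
Proof.
rewrite /twist sqnorm_toC; congr (_ * cis _); move: i => [[|[|[|//]]] ?].
- rewrite (_ : Ordinal _ == 0 = true) // /pt/= sqrrN.
  by rewrite (_ : 2 ^+ 2 = 4) ?twist_angle4//; ring.
- rewrite (_ : Ordinal _ == 0 = false) // /pt/= sqrrN expr1n.
  by rewrite twist_angle1.
- by rewrite (_ : Ordinal _ == 0 = false) // /pt/= expr1n twist_angle1.
Qed.

End twist.

(** * The motions of the curve and of the twist *)

Section twist_braid.
Variable R : realType.
Local Notation C := (Rcomplex R).
Local Notation D := (@discD R).
Local Notation I := (`[0, 1]%classic : set R).
Local Notation K := (fiber (@curveS R) 1).
Local Notation pt := (pt R).

Lemma cis4pi : cis (4 * pi) = 1 :> C.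
Proof. by rewrite (_ : 4 * pi = 2 * pi + 2 * pi); [rewrite cisD2pi cis2pi|ring]. Qed.

Lemma K_disc z : K z -> D z.
Proof. by case. Qed.

Lemma twist11_K z : K z -> twist 1 1 z = z.
Proof.
move=> /curveS_fiber1[i ->]; rewrite twist_pt !mul1r.
by case: ifP => _; rewrite ?cis4pi ?cis2pi mulr1.
Qed.

Lemma twist11_image : twist 1 1 @` (D `&` K) = K.
Proof.
apply/seteqP; split=> [_ [z [_ Kz] <-]|z Kz]; first by rewrite twist11_K.
by exists z; [split => //; exact: K_disc|exact: twist11_K].
Qed.

Definition twist_diffeo : braid_diffeo K :=
  BraidDiffeo (diffeo_twist 1 1) (@twist_bd R 1 1) twist11_image.

Definition twist_braid : braid (@Ku0 R) := braid_class (@Ku0 R) twist_diffeo.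

(** Two time changes u and v drive the inner and the outer twist separately;
    all of them realize motions that induce the same braid. *)
Section family.
Variables u v : R -> R.
Hypotheses (cu : continuous u) (cv : continuous v).
Hypotheses (u_0 : u 0 = 0) (v_0 : v 0 = 0) (u_1 : u 1 = 1) (v_1 : v 1 = 1).

Lemma twist_family_realizes n (m : 'I_n -> R -> C) :
  (forall i t, I t -> twist (u t) (v t) (m i 0) = m i t) ->
  realizes m (fun t => twist (u t) (v t)).
Proof.
move=> mE; split=> //.
- apply: continuous_subspaceT; apply: continuous_twist.
  + exact: continuous_compT (@continuous_fst R C) cu.
  + exact: continuous_compT (@continuous_fst R C) cv.
  + exact: continuous_snd.
- by move=> t _; split=> [|z]; [exact: diffeo_twist|exact: twist_bd].
- by move=> z _; rewrite u_0 v_0 twist00.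
Qed.

Lemma twist_family_braid n (m : 'I_n -> R -> C) (beta : braid (@Ku0 R)) :
  motion K m -> (forall i t, I t -> twist (u t) (v t) (m i 0) = m i t) ->
  induced_braid m beta <-> beta = twist_braid.
Proof.
move=> mK mE; have mPhi := twist_family_realizes mE.
have phiE z : D z -> twist_diffeo z = twist (u 1) (v 1) z by rewrite u_1 v_1.
split=> [[_ [Phi [phi [rPhi phiPhi ->]]]]|->]; last first.
  by split=> //; exists (fun t => twist (u t) (v t)), twist_diffeo.
apply: (@braid_class_eq R K (@Ku0 R) n m _ (fun t => twist (- u t) (- v t))
  _ _ _ mK mPhi phiE rPhi phiPhi).
  apply: continuous_subspaceT; apply: continuous_twist.
  - by move=> x; apply: cvgN; exact: (continuous_compT (@continuous_fst R C) cu).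
  - by move=> x; apply: cvgN; exact: (continuous_compT (@continuous_fst R C) cv).
  - exact: continuous_snd.
by move=> t z _ Dz; split; [exact: twist_disc|exact: twistK|exact: twistVK].
Qed.

Lemma pt_inj : injective (fun i => toC (pt i) : C).
Proof.
move=> i j /(congr1 (@complex.Re R))/=; case: i j => -[|[|[|//]]] ?
  [[|[|[|//]]] ?]; rewrite /Defs.pt /= => e; apply/val_inj => //=; exfalso; lra.
Qed.

Lemma twist_family_motion :
  motion K (fun i t => twist (u t) (v t) (toC (pt i))).
Proof.
have ptK i : K (toC (pt i)) by apply/curveS_fiber1; exists i.
split.
- move=> i; apply: continuous_subspaceT; apply: continuous_twist => //.
  by move=> x; exact: cst_continuous.
- by move=> i t _; apply/twist_disc/K_disc.
- move=> i j t _ /eqP ij /(congr1 (twist (- u t) (- v t))).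
  by rewrite !twistK => /pt_inj.
- apply/seteqP; split=> [_ [i _ <-]|z /curveS_fiber1[i ->]].
    by rewrite u_0 v_0 twist00.
  by exists i => //; rewrite u_0 v_0 twist00.
- apply/seteqP; split=> [_ [i _ <-]|z /curveS_fiber1[i ->]].
    by rewrite u_1 v_1 twist11_K.
  by exists i => //; rewrite u_1 v_1 twist11_K.
Qed.

Lemma twist_pt_braid (beta : braid (@Ku0 R)) :
  induced_braid (fun i t => twist (u t) (v t) (toC (pt i))) beta <->
  beta = twist_braid.
Proof.
apply: twist_family_braid; first exact: twist_family_motion.
by move=> i t _; rewrite u_0 v_0 twist00.
Qed.

End family.

(** The inner twist is run on [0, 1/2] and the outer one on [1/2, 1]. *)
Lemma twist_motion_braid (beta : braid (@Ku0 R)) :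
  induced_braid (@twist_motion R) beta <-> beta = twist_braid.
Proof.
pose u t : R := Num.min (2 * t) 1.
pose v t : R := Num.max (2 * t - 1) 0.
have cu : continuous u.
  move=> t; exact: (@continuous_min R R (fun t => 2 * t) (fun=> 1) t
    (@continuous_double R t) (@cst_continuous _ _ _ _)).
have cv : continuous v.
  move=> t; exact: (@continuous_max R R (fun t => 2 * t - 1) (fun=> 0) t
    (@continuous_doubleB R t) (@cst_continuous _ _ _ _)).
rewrite -(twist_pt_braid cu cv); last first.
- by rewrite /v max_l; lra.
- by rewrite /u min_r; lra.
- by rewrite /v max_r; lra.
- by rewrite /u min_l; lra.
suff -> : (fun i t => twist (u t) (v t) (toC (pt i))) = @twist_motion R by [].
apply/funext => i; apply/funext => t; rewrite twist_pt /twist_motion.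
have rot a s : rotation 0 (toC (pt i)) a s = toC (pt i) * cis (s * a) :> C.
  by rewrite /rotation add0r subr0 [RHS]mulrC (mulrC a).
case: ifP => i0; rewrite /concat /u /v; case: (leP t 2^-1) => th.
- by rewrite max_r ?mul0r ?cis0 ?mulr1//; lra.
- by rewrite max_l ?rot//; lra.
- by rewrite min_l ?rot//; lra.
- by rewrite min_r ?mul1r ?cis4pi ?mulr1//; lra.
Qed.

Lemma fiber_curveS_cis t y : fiber (@curveS R) (cis (2 * pi * t)) y <->
  exists i, y = twist t t (toC (pt i)).
Proof.
set x : C := cis (2 * pi * t).
have x2 : cis (t * (4 * pi)) = x ^+ 2 :> C.
  by rewrite expr2 -cisD; congr cis; ring.
have x1 : cis (t * (2 * pi)) = x :> C by congr cis; ring.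
have tw0 : twist t t (toC (pt 0)) = - (2 * x) :> C.
  by rewrite twist_pt /= x1 /Defs.pt /= toCN2 mulNr.
have tw1 : twist t t (toC (pt 1)) = - x ^+ 2 :> C.
  by rewrite twist_pt /= x2 /Defs.pt /= toCN1 mulN1r.
have tw2 : twist t t (toC (pt 2)) = x ^+ 2 :> C.
  by rewrite twist_pt /= x2 /Defs.pt /= -[toC 1]/(1 : C) mul1r.
rewrite /fiber /curveS /=; split.
  move=> [_ _ /eqP]; rewrite !mulf_eq0 -orbA => /or3P[] /eqP h.
  - by exists 0; rewrite tw0; apply/eqP; rewrite -addr_eq0 addrC h.
  - by exists 1; rewrite tw1; apply/eqP; rewrite -addr_eq0 h.
  - by exists 2; rewrite tw2; apply/eqP; rewrite -subr_eq0 h.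
move=> [i yE]; split.
- by rewrite /discE/= norm_cis.
- by rewrite yE; apply/twist_disc/K_disc/curveS_fiber1; exists i.
- have [i0|[i0|i0]] : i = 0 \/ i = 1 \/ i = 2.
    by case: i {yE} => -[|[|[|//]]] ?; [left|right; left|right; right];
      apply/val_inj.
  + by rewrite yE i0 tw0 subrr !mul0r.
  + by rewrite yE i0 tw1 addNr mulr0 mul0r.
  + by rewrite yE i0 tw2 subrr mulr0.
Qed.

(** K is real and finite: a jump of the real part would make it take one of
    the values 0 and -3/2, which separate the points of K. *)
Lemma path_in_K_constant (f : R -> C) : {within I, continuous f} ->
  (forall t, I t -> K (f t)) -> forall t, I t -> f t = f 0.
Proof.
move=> cf fK t It.
have I0 := I0 R.
pose g s := complex.Re (f s).
have cg : {within I, continuous g}.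
  apply: (@within_comp R C R I setT) => //.
  exact/continuous_subspaceT/continuous_Re.
have gK s : I s -> exists i, f s = toC (pt i) /\ g s = pt i.
  by move=> /fK/curveS_fiber1[i fE]; exists i; rewrite /g fE.
have [i [fi gi]] := gK _ It; have [j [fj gj]] := gK _ I0.
have [ij|/eqP ij] := eqVneq i j; first by rewrite fi fj ij.
have t0 : 0 <= t by move: It; rewrite /= in_itv/= => /andP[].
have cgt : {within `[0, t], continuous g}.
  apply: continuous_subspaceW cg => s; rewrite /= !in_itv/=.
  by move: It; rewrite /= in_itv/=; lra.
have [w wb wK] : exists2 w, Num.min (g 0) (g t) <= w <= Num.max (g 0) (g t) &
    forall k, pt k != w.
  (* 0 separates 1 from the other two points, and -3/2 separates -2 from -1. *)
  have ptN0 k : pt k != 0.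
    by case: k => -[|[|[|//]]] ?; rewrite /Defs.pt /=; apply/eqP; lra.
  have ptNmid k : pt k != - (3 / 2).
    by case: k => -[|[|[|//]]] ?; rewrite /Defs.pt /=; apply/eqP; lra.
  rewrite gi gj; move: ij; case: i {fi gi} => -[|[|[|//]]] ?;
  case: j {fj gj} => -[|[|[|//]]] ? ij; rewrite /Defs.pt /=;
    first [by case: ij; apply/val_inj
          |exists 0 => //; rewrite ge_min le_max; apply/andP; split; lra
          |exists (- (3 / 2)) => //; rewrite ge_min le_max; apply/andP; split; lra].
have [s s0t gs] := IVT t0 cgt wb.
have Is : I s by move: s0t It; rewrite /= !in_itv/=; lra.
by have [k [_ gk]] := gK _ Is; move: (wK k); rewrite -gk gs eqxx.
Qed.

(** The motion is only known to sweep out the fibres. Untwisting it gives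
    continuous paths in the finite set K, so each of its points is carried by
    the twist of angle t * a. *)
Lemma local_monodromy_braid (beta : braid (@Ku0 R)) :
  local_braid_monodromy 3 beta <-> beta = twist_braid.
Proof.
have cid : continuous (id : R -> R) by move=> x; exact: cvg_id.
split=> [[m [mS mb]]|->].
  have [mK _] := mb.
  have [cm _ _ m0 _] := mK.
  suff mE i t : I t -> twist t t (m i 0) = m i t.
    exact/(twist_family_braid cid cid erefl erefl erefl erefl _ mK mE).
  have bk : {within I, continuous (fun t => twist (- t) (- t) (m i t))}.
    apply: (@within_comp R (R * C)%type C I setT
      (fun t => (t, m i t)) (fun x => twist (- x.1) (- x.1) x.2)) => //.
      by apply: (@within_pair R R C); [exact: continuous_subspaceT|exact: cm].
    apply: continuous_subspaceT; apply: continuous_twist; last exact: continuous_snd.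
      by move=> x; apply: cvgN; exact: continuous_fst.
    by move=> x; apply: cvgN; exact: continuous_fst.
  move=> It; have := path_in_K_constant bk _ It.
  rewrite oppr0 twist00 => <-; first by rewrite twistVK.
  move=> s Is.
  have : fiber (@curveS R) (cis (2 * pi * s)) (m i s).
    by rewrite -mS//; exists i.
  by move=> /fiber_curveS_cis[j ->]; rewrite twistK; apply/curveS_fiber1; exists j.
exists (fun i t => twist t t (toC (pt i))); split; last exact/twist_pt_braid.
move=> t _; apply/seteqP; split=> [_ [i _ <-]|y /fiber_curveS_cis[i ->]].
  by apply/fiber_curveS_cis; exists i.
by exists i.
Qed.

End twist_braid.

(** * Polar coordinates and the punctured disc *)

Section polar.
Variable R : realType.
Local Notation C := (Rcomplex R).
Local Notation D := (@discD R).
Local Notation I := (`[0, 1]%classic : set R).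
Local Notation K := (fiber (@curveS R) 1).
Local Notation A := (D `\` K).
Local Notation pt := (pt R).
Local Notation cl := (@path_class R C A (base (@Ku0 R))).

(** Polar coordinates centred at the real point q. *)
Definition polar (q rho theta : R) : C :=
  Complex (q + rho * cos theta) (rho * sin theta).

Definition polar_arc (q rho alpha beta : R) : R -> C :=
  fun t => polar q rho (alpha + t * (beta - alpha)).

Lemma continuous_polar (X : topologicalType) q (rho theta : X -> R) :
  continuous rho -> continuous theta ->
  continuous (fun x => polar q (rho x) (theta x)).
Proof.
move=> cr ct; apply: continuous_complex => x.
- apply: cvgD; first exact: cvg_cst.
  by apply: cvgM; [exact: cr|exact: (continuous_compT ct (@continuous_cos R))].
- by apply: cvgM; [exact: cr|exact: (continuous_compT ct (@continuous_sin R))].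
Qed.

Lemma polarD2pi q rho theta : polar q rho (theta + 2 * pi) = polar q rho theta.
Proof. by rewrite /polar mulr_natl cosD2pi sinD2pi. Qed.

Lemma polarN q rho theta : polar q (- rho) theta = polar q rho (theta + pi).
Proof. by rewrite /polar cosDpi sinDpi !mulrN !mulNr. Qed.

Lemma sqnorm_polar rho theta : sqnorm (polar 0 rho theta) = rho ^+ 2.
Proof. by rewrite /sqnorm /= add0r !exprMn -mulrDr cos2Dsin2 mulr1. Qed.

Lemma norm_polar rho theta : `|polar 0 rho theta| = `|rho|.
Proof. by rewrite norm_sqnorm sqnorm_polar sqrtr_sqr. Qed.

Lemma polar_disc q rho theta : `|q| + `|rho| <= 4 -> D (polar q rho theta).
Proof.
move=> qr; rewrite /discD /= (_ : polar q rho theta = toC q + polar 0 rho theta).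
  by rewrite (le_trans (ler_normD _ _))// norm_toC norm_polar.
by apply/eqP; rewrite eq_complex /= !add0r !eqxx.
Qed.

Lemma twist_polar u v rho theta : twist u v (polar 0 rho theta) =
  polar 0 rho (theta + twist_angle u v (rho ^+ 2)).
Proof.
rewrite /twist sqnorm_polar /polar /cis cosD sinD.
by apply/eqP; rewrite eq_complex /=; apply/andP; split; apply/eqP; ring.
Qed.

Lemma polar_arc_shift q rho alpha beta :
  polar_arc q rho (alpha + 2 * pi) (beta + 2 * pi) = polar_arc q rho alpha beta.
Proof.
apply/funext => t; rewrite /polar_arc -[RHS]polarD2pi; congr polar; ring.
Qed.

Lemma polar_arcN q rho alpha beta :
  polar_arc q (- rho) alpha beta = polar_arc q rho (alpha + pi) (beta + pi).
Proof. by apply/funext => t; rewrite /polar_arc polarN; congr polar; ring. Qed.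

Lemma polar_arc0 q rho alpha beta : polar_arc q rho alpha beta 0 = polar q rho alpha.
Proof. by rewrite /polar_arc mul0r addr0. Qed.

Lemma polar_arc1 q rho alpha beta : polar_arc q rho alpha beta 1 = polar q rho beta.
Proof. by rewrite /polar_arc mul1r subrKC. Qed.

Lemma polar_arc_rev q rho alpha beta :
  rev_path (polar_arc q rho alpha beta) = polar_arc q rho beta alpha.
Proof. by apply/funext => t; rewrite /Defs.rev_path /polar_arc; congr polar; ring. Qed.

Lemma continuous_arc q rho alpha beta : continuous (polar_arc q rho alpha beta).
Proof.
apply: continuous_polar => t; first exact: cst_continuous.
by apply: cvgD; [exact: cvg_cst|apply: cvgM; [exact: cvg_id|exact: cvg_cst]].
Qed.

Lemma punctured_Im z : D z -> complex.Im z != 0 -> A z.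
Proof.
move=> Dz /eqP z0; split=> // /curveS_fiber1[i zE]; by apply: z0; rewrite zE.
Qed.

Lemma punctured_norm z : D z -> `|z| != 1 -> `|z| != 2 -> A z.
Proof.
move=> Dz z1 z2; split=> // /curveS_fiber1[i zE]; move: z1 z2; rewrite zE norm_toC.
by case: i {zE} => -[|[|[|//]]] ?; rewrite /Defs.pt /= ?normrN ?normr1 ?eqxx//
  ger0_norm ?eqxx.
Qed.

Lemma segment_closed_disc : segment_closed D.
Proof.
move=> x y s; rewrite /discD /= => Dx Dy; rewrite in_itv /= => /andP[s0 s1].
rewrite (le_trans (ler_normD _ _))// !normcZ !ger0_norm ?subr_ge0//; nra.
Qed.

Lemma segmentE (x y : C) t : segment x y t = (1 - t) *: x + t *: y.
Proof. by rewrite /segment scalerBr scalerBl scale1r addrA addrAC. Qed.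

Lemma segment_is_path (B : set C) x y : segment_closed B -> B x -> B y ->
  is_path B x y (segment x y).
Proof.
move=> cB Bx By; split.
- exact/continuous_subspaceT/continuous_segment.
- by move=> t It; rewrite segmentE; exact: cB.
- by rewrite /segment scale0r addr0.
- by rewrite /segment scale1r subrKC.
Qed.

(** The points of the disc strictly below (e < 0) or above (e > 0) the real
    axis, together with those of the open real interval ]a, b[. One definition
    for both sides lets a path change sides through ]a, b[. *)
Definition half_disc (e a b : R) : set C := [set z | D z /\
  (0 < e * complex.Im z \/ complex.Im z = 0 /\ a < complex.Re z < b)].

(** A proper convex combination of two points of which at least one lies off
    the axis lies off the axis, on the same side. *)
Lemma segment_closed_half e a b : segment_closed (half_disc e a b).
Proof.
move=> x y s [Dx hx] [Dy hy] Is; split; first exact: segment_closed_disc.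
move: Is; rewrite /= in_itv /= => /andP[]; rewrite le_eqVlt => /predU1P[<-|s0].
  by move=> _; rewrite subr0 scale1r scale0r addr0.
rewrite le_eqVlt => /predU1P[->|s1].
  by rewrite subrr scale1r scale0r add0r.
case: x y {Dx Dy} hx hy => x1 x2 [y1 y2] /= hx hy.
have s1' : 0 < 1 - s by rewrite subr_gt0.
rewrite mulrDr !(mulrCA e).
case: hx => [hx|[-> /andP[ax bx]]]; case: hy => [hy|[-> /andP[ay By]]].
- by left; apply: addr_gt0; exact: mulr_gt0.
- by left; rewrite !mulr0 addr0 mulr_gt0//.
- by left; rewrite !mulr0 add0r mulr_gt0//.
- by right; rewrite !mulr0 addr0; split=> //; apply/andP; split; nra.
Qed.

Lemma half_punctured e a b : (forall i, ~~ (a < pt i < b)) -> half_disc e a b `<=` A.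
Proof.
move=> gap z [Dz [z0|[z0 ab]]].
  by apply: punctured_Im => //; apply/eqP => z0'; rewrite z0' mulr0 ltxx in z0.
split=> // /curveS_fiber1[i zE].
by have /negP := gap i; apply; rewrite zE in ab.
Qed.

Lemma half_intro e a b z : D z -> 0 < e * complex.Im z -> half_disc e a b z.
Proof. by move=> Dz z0; split=> //; left. Qed.

Lemma u0_polar : u0 R = polar 0 4 (- (pi / 2)).
Proof.
by rewrite /polar cosN sinN cos_pihalf sin_pihalf mulr0 addr0 mulrN mulr1.
Qed.

Lemma D_u0 : D (u0 R).
Proof. by rewrite /discD /= bdD_u0. Qed.

(** Points of the closed lower half are seen from the base point -4i, because
    only the end of the segment can be real; the other ones are reached
    through 0. *)
Lemma reach_punctured z : A z -> reach R (base (@Ku0 R)) z.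
Proof.
move=> Az; have [Dz _] := Az.
have D0 : D 0 by rewrite /discD /= normr0.
have low (w : C) : A w -> complex.Im w <= 0 ->
    is_path A (u0 R) w (segment (u0 R) w).
  move=> Aw w0; have [Dw _] := Aw; split.
  - exact/continuous_subspaceT/continuous_segment.
  - move=> t; rewrite /= in_itv /= => /andP[t0]; rewrite le_eqVlt.
    move=> /predU1P[->|t1]; first by rewrite /segment scale1r subrKC.
    rewrite segmentE; apply: punctured_Im.
      by apply: segment_closed_disc => //; [exact: D_u0|rewrite /= in_itv /=; lra].
    by case: (w) w0 => w1 w2 /= w0; rewrite lt_eqF//; nra.
  - by rewrite /segment scale0r addr0.
  - by rewrite /segment scale1r subrKC.
have [z0|z0] := leP (complex.Im z) 0; first by exists (segment (u0 R) z); exact: low.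
have A0 : A 0 by apply: punctured_norm => //; rewrite normr0 eq_sym; apply/eqP; lra.
exists (concat (segment (u0 R) 0) (segment 0 z)).
apply: (is_path_concat (y := 0)); first exact: low.
have gap i : ~~ (-1 < pt i < 1).
  by case: i => -[|[|[|//]]] ?; rewrite /Defs.pt /=; apply/negP; lra.
have [c s i0 i1] : is_path (half_disc 1 (-1) 1) 0 z (segment 0 z).
  apply: segment_is_path; first exact: segment_closed_half.
    by split=> //; right; rewrite /= ltrN10 ltr01.
  by apply: half_intro => //; rewrite mul1r.
by split=> // t It; apply: (half_punctured gap); exact: s.
Qed.

Lemma clM x y z f g : is_path A x y f -> is_path A y z g ->
  cl (concat f g) = (cl f * cl g)%g.
Proof.
move=> fP; apply: path_class_concat (fP); apply: reach_punctured.
by case: fP => _ + <- _; apply; exact: I0.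
Qed.

Lemma clV x y f : is_path A x y f -> cl (rev_path f) = ((cl f)^-1)%g.
Proof.
move=> fP; apply: path_class_rev (fP); apply: reach_punctured.
by case: fP => _ + <- _; apply; exact: I0.
Qed.

Lemma cl_eq x y f g : is_path A x y f -> is_path A x y g ->
  homotopic A f g -> cl f = cl g.
Proof.
move=> fP; apply: path_class_homotopic (fP); apply: reach_punctured.
by case: fP => _ + <- _; apply; exact: I0.
Qed.

Lemma cl_constant (x : C) f : A x -> (forall t, f t = x) -> cl f = 1%g.
Proof.
move=> Ax fx; rewrite (_ : f = cst x); last exact/funext.
exact/path_class_cst/reach_punctured.
Qed.

Lemma is_path_sub (B B' : set C) x y (f : R -> C) : B `<=` B' ->
  is_path B x y f -> is_path B' x y f.
Proof. by move=> BB [cf Bf f0 f1]; split=> // t /Bf/BB. Qed.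

(** The two crossing points lie in both convex sets, so the segment between
    them can be inserted in each of the two halves. *)
Lemma cl_crossing (B B' : set C) x y w w' f g f' g' :
  segment_closed B -> segment_closed B' -> B `<=` A -> B' `<=` A ->
  is_path B x w f -> is_path B' w y g -> is_path B x w' f' -> is_path B' w' y g' ->
  (cl f * cl g = cl f' * cl g')%g.
Proof.
move=> cB cB' BA BA' fP gP fP' gP'.
have Bw : B w by case: fP => _ + _ <-; apply; exact: I1.
have Bw' : B w' by case: fP' => _ + _ <-; apply; exact: I1.
have B'w : B' w by case: gP => _ + <- _; apply; exact: I0.
have B'w' : B' w' by case: gP' => _ + <- _; apply; exact: I0.
have sP := segment_is_path cB Bw Bw'.
have sP' := segment_is_path cB' B'w B'w'.
have cid (E : set C) : {within E, continuous (id : C -> C)}.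
  by apply: continuous_subspaceT => z; exact: cvg_id.
have e1 : cl f' = (cl f * cl (segment w w'))%g.
  have p := is_path_concat fP sP.
  rewrite -(clM (is_path_sub BA fP) (is_path_sub BA sP)).
  apply: cl_eq (is_path_sub BA fP') (is_path_sub BA p) _.
  exact: (homotopic_convex cB (cid B) BA fP' p).
have e2 : cl g = (cl (segment w w') * cl g')%g.
  have p := is_path_concat sP' gP'.
  rewrite -(clM (is_path_sub BA' sP') (is_path_sub BA' gP')).
  apply: cl_eq (is_path_sub BA' gP) (is_path_sub BA' p) _.
  exact: (homotopic_convex cB' (cid B') BA' gP p).
by rewrite e1 e2 !mulgA.
Qed.

End polar.

(** * Crossing the real axis, and the generators *)

Section crossings.
Variable R : realType.
Local Notation C := (Rcomplex R).
Local Notation D := (@discD R).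
Local Notation I := (`[0, 1]%classic : set R).
Local Notation K := (fiber (@curveS R) 1).
Local Notation A := (D `\` K).
Local Notation pt := (pt R).
Local Notation cl := (@path_class R C A (base (@Ku0 R))).
Local Notation pi1 := (pi1 R (base (@Ku0 R))).
Local Notation u := (u0 R).
Local Notation v := (polar 0 4 (pi / 2) : C).

(** The outermost gaps of the real axis are bounded by -5 and 5, outside of the
    disc, since they contain the points -4 and 4 of its boundary. *)
Definition gap_lo (k : nat) : R := [:: -5; -2; -1; 1]`_k.
Definition gap_hi (k : nat) : R := [:: -2; -1; 1; 5]`_k.

Lemma gapP (k : nat) (i : 'I_3) : (k < 4)%N -> ~~ (gap_lo k < pt i < gap_hi k).
Proof.
case: i => -[|[|[|//]]] ?; case: k => [|[|[|[|//]]]] _;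
  rewrite /gap_lo /gap_hi /Defs.pt /=; apply/negP; lra.
Qed.

(** e is the class of a path from -4i to 4i that passes from the lower to the
    upper half disc through the k-th gap. *)
Definition crosses (k : nat) (e : pi1) := exists w f g,
  [/\ is_path (half_disc (-1) (gap_lo k) (gap_hi k)) u w f,
      is_path (half_disc 1 (gap_lo k) (gap_hi k)) w v g & e = (cl f * cl g)%g].

Lemma crosses_uniq k e e' : (k < 4)%N -> crosses k e -> crosses k e' -> e = e'.
Proof.
move=> k4 [w [f [g [fP gP ->]]]] [w' [f' [g' [fP' gP' ->]]]].
have gap i := gapP i k4.
exact: cl_crossing (@segment_closed_half _ _ _ _) (@segment_closed_half _ _ _ _)
  (half_punctured gap) (half_punctured gap) fP gP fP' gP'.
Qed.

Lemma polar_arc_is_path (B : set C) q rho alpha beta :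
  (forall theta, alpha <= theta <= beta \/ beta <= theta <= alpha ->
     B (polar q rho theta)) ->
  is_path B (polar q rho alpha) (polar q rho beta) (polar_arc q rho alpha beta).
Proof.
move=> arcB; split; [|move=> t; rewrite /= in_itv /= => /andP[t0 t1]| |].
- exact/continuous_subspaceT/continuous_arc.
- apply: arcB; case: (leP alpha beta) => ab; [left|right];
    apply/andP; split; nra.
- exact: polar_arc0.
- exact: polar_arc1.
Qed.

(** The polar map is defined on the whole line of angles, which is convex, and
    sends it into the punctured disc: only the end points of the angle
    matter. *)
Lemma cl_arcM q rho alpha beta gamma : (forall theta, A (polar q rho theta)) ->
  (cl (polar_arc q rho alpha beta) * cl (polar_arc q rho beta gamma))%g =
  cl (polar_arc q rho alpha gamma).
Proof.
move=> circA.
have aP a b := @polar_arc_is_path A q rho a b (fun theta _ => circA theta).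
rewrite -(clM (aP _ _) (aP _ _)).
apply: cl_eq (is_path_concat (aP _ _) (aP _ _)) (aP _ _) _.
pose lin (a b : R) : R -> R^o := fun t => a + t * (b - a).
have linP a b : is_path (setT : set R^o) a b (lin a b).
  split=> //; rewrite /lin ?mul0r ?addr0 ?mul1r ?subrKC//.
  apply: continuous_subspaceT => t; apply: cvgD; first exact: cvg_cst.
  by apply: cvgM; [exact: cvg_id|exact: cvg_cst].
have cp : {within (setT : set R^o), continuous (polar q rho : R^o -> C)}.
  apply: continuous_subspaceT; apply: continuous_polar => t.
    exact: cst_continuous.
  exact: cvg_id.
have := @homotopic_convex R R^o C A setT _ _ _ _ _ _ cp
  (fun theta _ => circA theta) (is_path_concat (linP alpha beta) (linP beta gamma))
  (linP alpha gamma).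
rewrite (_ : polar q rho \o concat (lin alpha beta) (lin beta gamma) =
  concat (polar_arc q rho alpha beta) (polar_arc q rho beta gamma)); last first.
  by apply/funext => t; rewrite /concat /=; case: ifP.
by apply.
Qed.

Lemma cl_arcV q rho alpha beta : (forall theta, A (polar q rho theta)) ->
  ((cl (polar_arc q rho alpha beta))^-1)%g = cl (polar_arc q rho beta alpha).
Proof.
move=> circA; rewrite -(polar_arc_rev q rho alpha beta); apply/esym/clV.
exact: (@polar_arc_is_path A _ _ _ _ (fun theta _ => circA theta)).
Qed.

Lemma half_polar (e a b q rho theta : R) : `|q| + `|rho| <= 4 ->
  0 < e * (rho * sin theta) \/ sin theta = 0 /\ a < q + rho * cos theta < b ->
  half_disc e a b (polar q rho theta).
Proof.
move=> qr h; split; first exact: polar_disc.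
by case: h => [h|[h1 h2]]; [left|right; rewrite /= h1 mulr0].
Qed.

Lemma sin_lt0_piN (x : R) : - pi < x < 0 -> sin x < 0.
Proof.
move=> /andP[x0 x1]; rewrite -oppr_gt0 -sinN; apply: sin_gt0_pi; lra.
Qed.

Lemma D_v : D v.
Proof. by apply: polar_disc; rewrite normr0 add0r ger0_norm. Qed.

Lemma half_u (a b : R) : half_disc (-1) a b u.
Proof. by apply: half_intro; [exact: D_u0|rewrite /= mulN1r opprK]. Qed.

Lemma half_v (a b : R) : half_disc 1 a b v.
Proof.
apply: half_intro; first exact: D_v.
by rewrite /= sin_pihalf mul1r mulr1.
Qed.

(** A circle about a real point that avoids the punctures is entered from -4i
    at the angle -theta0 in its lower half, followed to its top on either side
    and left towards 4i. The same statement serves for the small circles of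
    the lassos (where theta0 is the direction of the segment from -4i) and for
    the circles about 0 (where theta0 = pi / 2). *)
Section circle.
Variables (q rho theta0 : R).
Hypothesis theta0P : 0 < theta0 < pi.
Hypothesis rho0 : 0 < rho.
Hypothesis qr : `|q| + rho <= 4.
Hypothesis circA : forall theta, A (polar q rho theta).

Let rhoE : `|rho| = rho. Proof. by rewrite ger0_norm// ltW. Qed.

Let half_bottom a b : half_disc (-1) a b (polar q rho (- theta0)).
Proof.
apply: half_polar; rewrite ?rhoE//; left.
by rewrite mulN1r oppr_gt0 pmulr_rlt0//; apply: sin_lt0_piN; have := theta0P; lra.
Qed.

Let half_top a b : half_disc 1 a b (polar q rho (pi / 2)).
Proof. by apply: half_polar; rewrite ?rhoE//; left; rewrite sin_pihalf mul1r mulr1. Qed.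

Let seg_bottom a b : is_path (half_disc (-1) a b) u (polar q rho (- theta0))
  (segment u (polar q rho (- theta0))).
Proof.
by apply: segment_is_path => //; [exact: segment_closed_half|exact: half_u].
Qed.

Let seg_top a b : is_path (half_disc 1 a b) (polar q rho (pi / 2)) v
  (segment (polar q rho (pi / 2)) v).
Proof.
by apply: segment_is_path => //; [exact: segment_closed_half|exact: half_v].
Qed.

Let around (theta1 : R) := (cl (segment u (polar q rho (- theta0))) *
  cl (polar_arc q rho (- theta0) theta1) * cl (segment (polar q rho (pi / 2)) v))%g.

Let crosses_at k theta1 theta2 : (k < 4)%N -> polar q rho theta2 = polar q rho (pi / 2) ->
  is_path (half_disc (-1) (gap_lo k) (gap_hi k)) (polar q rho (- theta0)) (polar q rho theta1)
    (polar_arc q rho (- theta0) theta1) ->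
  is_path (half_disc 1 (gap_lo k) (gap_hi k)) (polar q rho theta1) (polar q rho theta2)
    (polar_arc q rho theta1 theta2) ->
  crosses k (around theta2).
Proof.
move=> k4 theta2E f1P g1P.
have gap i := gapP i k4.
have sA e := half_punctured (e := e) gap.
exists (polar q rho theta1),
  (concat (segment u (polar q rho (- theta0))) (polar_arc q rho (- theta0) theta1)),
  (concat (polar_arc q rho theta1 theta2) (segment (polar q rho (pi / 2)) v)).
have s1 := seg_bottom (gap_lo k) (gap_hi k); have s2 := seg_top (gap_lo k) (gap_hi k).
rewrite theta2E in g1P.
split.
- exact: is_path_concat s1 f1P.
- exact: is_path_concat g1P s2.
- rewrite (clM (is_path_sub (@sA _) s1) (is_path_sub (@sA _) f1P)).
  rewrite (clM (is_path_sub (@sA _) g1P) (is_path_sub (@sA _) s2)).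
  by rewrite /around -(cl_arcM (- theta0) theta1 theta2 circA) !mulgA.
Qed.

Lemma crosses_right k : (k < 4)%N -> gap_lo k < q + rho < gap_hi k ->
  crosses k (around (pi / 2)).
Proof.
move=> k4 kP; apply: (@crosses_at k 0) => //; apply: polar_arc_is_path => theta.
- have [->|t0] := eqVneq theta 0.
    by move=> _; apply: half_polar; rewrite ?rhoE// sin0 cos0 mulr1; right.
  move=> h; have {}h : - theta0 <= theta < 0 by rewrite lt_neqAle t0; have := theta0P; lra.
  apply: half_polar; rewrite ?rhoE//; left.
  by rewrite mulN1r oppr_gt0 pmulr_rlt0//; apply: sin_lt0_piN; have := theta0P; lra.
- have [->|t0] := eqVneq theta 0.
    by move=> _; apply: half_polar; rewrite ?rhoE// sin0 cos0 mulr1; right.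
  move=> h; have {}h : 0 < theta <= pi / 2 by rewrite lt_neqAle eq_sym t0; have := theta0P; lra.
  apply: half_polar; rewrite ?rhoE//; left.
  by rewrite mul1r pmulr_rgt0//; apply: sin_gt0_pi; have := theta0P; lra.
Qed.

(** Clockwise from -theta0, the circle meets the axis at the angle -pi and its
    top at -3 pi / 2. *)
Lemma crosses_left k : (k < 4)%N -> gap_lo k < q - rho < gap_hi k ->
  crosses k (around (- (3 * pi / 2))).
Proof.
have shift : pi / 2 = - (3 * pi / 2) + 2 * pi :> R by field.
move=> k4 kP; apply: (@crosses_at k (- pi)) => //.
- by rewrite shift polarD2pi.
- apply: polar_arc_is_path => theta; have [->|t0] := eqVneq theta (- pi).
    move=> _; apply: half_polar; rewrite ?rhoE//; right.
    by rewrite sinN sinpi oppr0 cosN cospi mulrN1.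
  move=> h; have {}h : - pi < theta <= - theta0 by rewrite lt_neqAle eq_sym t0; have := theta0P; lra.
  apply: half_polar; rewrite ?rhoE//; left.
  by rewrite mulN1r oppr_gt0 pmulr_rlt0//; apply: sin_lt0_piN; have := theta0P; lra.
- apply: polar_arc_is_path => theta; have [->|t0] := eqVneq theta (- pi).
    move=> _; apply: half_polar; rewrite ?rhoE//; right.
    by rewrite sinN sinpi oppr0 cosN cospi mulrN1.
  move=> h; have {}h : - (3 * pi / 2) <= theta < - pi by rewrite lt_neqAle t0; have := theta0P; lra.
  apply: half_polar; rewrite ?rhoE//; left.
  rewrite -sinD2pi -mulr_natl mul1r pmulr_rgt0//; apply: sin_gt0_pi; have := theta0P; lra.
Qed.

End circle.

Lemma unit_lower_arg (x y : R) : x ^+ 2 + y ^+ 2 = 1 -> y < 0 ->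
  exists theta, [/\ 0 < theta < pi, cos (- theta) = x & sin (- theta) = y].
Proof.
move=> xy y0.
have x1 : -1 < x < 1 by apply/andP; split; nra.
have xI : -1 <= x <= 1 by lra.
exists (acos x); split.
- by rewrite acos_gt0 ?acos_ltpi//; lra.
- by rewrite cosN acosK// in_itv.
- rewrite sinN sin_acos// (_ : 1 - x ^+ 2 = y ^+ 2); last by rewrite -xy; ring.
  by rewrite sqrtr_sqr ltr0_norm// opprK.
Qed.

Lemma polar_pt_punctured (i : 'I_3) r theta : 0 < r < 1 -> A (polar (pt i) r theta).
Proof.
move=> r01; split.
  apply: polar_disc; have := pt_norm R i; rewrite (@ger0_norm _ r); lra.
move=> /curveS_fiber1[j] e.
have : `|polar (pt i) r theta - toC (pt i)| = r :> R.
  rewrite (_ : _ - _ = polar 0 r theta); last first.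
    by apply/eqP; rewrite eq_complex /= subr0 add0r [pt i + _]addrC addrK !eqxx.
  by rewrite norm_polar ger0_norm//; lra.
rewrite e (_ : toC _ - _ = toC (pt j - pt i)); last first.
  by apply/eqP; rewrite eq_complex /= subr0 !eqxx.
rewrite norm_toC; have [->|] := pt_sep R j i; last by lra.
by rewrite subrr normr0; lra.
Qed.

(** The lasso goes round its circle counterclockwise; inserting a path from the
    top of the circle to 4i and back cuts it into a path through the gap on the
    right of the puncture and the inverse of one through the gap on the left. *)
Lemma cl_lasso (r : R) (i : 'I_3) : 0 < r < 1 ->
  exists e e', [/\ crosses i.+1 e, crosses i e' &
    cl (lasso u (toC (pt i)) r) = (e * e'^-1)%g].
Proof.
move=> r01; have [r0 r1] := andP r01.
have circA theta := polar_pt_punctured i theta r01.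
set d := `|u - toC (pt i)| : R.
have d2 : d ^+ 2 = pt i ^+ 2 + 16.
  by rewrite /d -sqnormE /sqnorm /=; ring.
have d0 : 0 < d.
  have : 0 <= d by rewrite /d normr_ge0.
  by rewrite le_eqVlt => /predU1P[d0|//]; move: d2; rewrite -d0; nra.
have xy1 : (- pt i / d) ^+ 2 + (- 4 / d) ^+ 2 = 1.
  rewrite !expr_div_n -mulrDl (_ : _ + _ = d ^+ 2); last by rewrite d2; ring.
  by rewrite mulfV// expf_neq0// gt_eqF.
have y0 : - 4 / d < 0 by rewrite pmulr_llt0 ?invr_gt0//; lra.
have [theta0 [theta0P ct st]] := unit_lower_arg xy1 y0.
(* a is the point where the lasso enters its circle, at the angle -theta0. *)
pose a := polar (pt i) r (- theta0).
have aE : toC (pt i) + (r / d) *: (u - toC (pt i)) = a.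
  apply/eqP; rewrite eq_complex /= ct st; apply/andP; split; apply/eqP; field.
    by rewrite gt_eqF.
  by rewrite gt_eqF.
have rotE : rotation (toC (pt i)) a (2 * pi) =
    polar_arc (pt i) r (- theta0) (2 * pi - theta0).
  apply/funext => t; rewrite /rotation /polar_arc.
  rewrite (_ : - theta0 + t * (2 * pi - theta0 - - theta0) = 2 * pi * t - theta0); last by ring.
  rewrite /a /polar cosD sinD cosN sinN.
  by apply/eqP; rewrite eq_complex /=; apply/andP; split; apply/eqP; ring.
have qr : `|pt i| + r <= 4 by have := pt_norm R i; lra.
have r1P : gap_lo i.+1 < pt i + r < gap_hi i.+1.
  by move: i {circA d d2 d0 xy1 y0 ct st a aE rotE qr} => [[|[|[|//]]] ?];
    rewrite /gap_lo /gap_hi /Defs.pt /=; lra.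
have r2P : gap_lo i < pt i - r < gap_hi i.
  by move: i {circA d d2 d0 xy1 y0 ct st a aE rotE qr r1P} => [[|[|[|//]]] ?];
    rewrite /gap_lo /gap_hi /Defs.pt /=; lra.
have c1 := crosses_right theta0P r0 qr circA (ltn_ord i : (i.+1 < 4)%N) r1P.
have c2 := crosses_left theta0P r0 qr circA (ltnW (ltn_ord i : (i.+1 < 4)%N)) r2P.
do 2 eexists; split; [exact: c1|exact: c2|].
rewrite /lasso -/d aE rotE.
have arcP a1 b1 := @polar_arc_is_path A (pt i) r a1 b1 (fun theta _ => circA theta).
have sP : is_path A u a (segment u a).
  have gap j := @gapP 0 j isT.
  apply: is_path_sub (half_punctured (e := -1) gap) _.
  apply: segment_is_path; first exact: segment_closed_half.
    exact: half_u.
  apply: half_polar; first by rewrite (gtr0_norm r0).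
  left; rewrite st (_ : -1 * _ = r * (4 / d)); last by ring.
  by rewrite mulr_gt0// divr_gt0.
have sP' : is_path A a u (segment a u).
  rewrite (_ : segment a u = rev_path (segment u a)); first exact: is_path_rev sP.
  by apply/funext => t; rewrite /Defs.rev_path !segmentE subKr addrC.
have aP : is_path A a a (polar_arc (pt i) r (- theta0) (2 * pi - theta0)).
  rewrite {2}/a -(polarD2pi (pt i) r (- theta0)) addrC; exact: arcP.
rewrite (clM sP (is_path_concat aP sP')) (clM aP sP').
rewrite (_ : segment a u = rev_path (segment u a)); last first.
  by apply/funext => t; rewrite /Defs.rev_path !segmentE subKr addrC.
rewrite (clV sP) -(cl_arcM _ (pi / 2) _ circA) !invgM !mulgA mulgK.
congr (_ * _ * _)%g; rewrite (cl_arcV _ _ circA).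
rewrite -[in RHS]polar_arc_shift; congr (cl (polar_arc _ _ _ _)); [by field|ring].
Qed.

End crossings.

(** * The action of the twist *)

Section action.
Variable R : realType.
Local Notation C := (Rcomplex R).
Local Notation D := (@discD R).
Local Notation I := (`[0, 1]%classic : set R).
Local Notation K := (fiber (@curveS R) 1).
Local Notation A := (D `\` K).
Local Notation pt := (pt R).
Local Notation cl := (@path_class R C A (base (@Ku0 R))).
Local Notation pi1 := (pi1 R (base (@Ku0 R))).
Local Notation u := (u0 R).
Local Notation v := (polar 0 4 (pi / 2) : C).
Local Notation phi := (twist 1 1 : C -> C).

(** A negative rho stands for the opposite direction, so that a ray can pass
    through 0. *)
Definition ray (rho0 rho1 theta : R) : R -> C :=
  fun t => polar 0 (rho0 + t * (rho1 - rho0)) theta.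

Lemma ray_segment rho0 rho1 theta :
  ray rho0 rho1 theta = segment (polar 0 rho0 theta) (polar 0 rho1 theta).
Proof.
apply/funext => t; apply/eqP; rewrite eq_complex /=; apply/andP.
by split; apply/eqP; ring.
Qed.

Lemma rayD2pi rho0 rho1 theta : ray rho0 rho1 (theta + 2 * pi) = ray rho0 rho1 theta.
Proof. by apply/funext => t; rewrite /ray polarD2pi. Qed.

Lemma twist_arc rho alpha beta : twist_angle 1 1 (rho ^+ 2) = 2 * pi \/ rho = 4 ->
  phi \o polar_arc 0 rho alpha beta = polar_arc 0 rho alpha beta.
Proof.
move=> h; apply/funext => t /=; rewrite /polar_arc; case: h => [h|->].
  by rewrite twist_polar h polarD2pi.
by apply: twist_bd; rewrite /bdD /= norm_polar ger0_norm.
Qed.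

(** The homotopy turns the point of modulus |rho| by the interpolation
    (1 - s) * a(rho^2) + s * c between the angle of the twist and the constant
    c. It meets no puncture: if |rho| is 1 or 2 then a(rho^2) = c, so these
    points stay at the angle theta + c, off the real axis. Meanwhile the ends
    of the ray slide along circles about 0. *)
Lemma cl_twist_ray rho0 rho1 theta c : `|rho0| <= 4 -> `|rho1| <= 4 ->
  sin (theta + c) != 0 ->
  (forall rho, rho0 <= rho <= rho1 \/ rho1 <= rho <= rho0 ->
    `|rho| = 1 \/ `|rho| = 2 -> twist_angle 1 1 (rho ^+ 2) = c) ->
  (cl (phi \o ray rho0 rho1 theta) *
   cl (polar_arc 0 rho1 (theta + twist_angle 1 1 (rho1 ^+ 2)) (theta + c)) =
   cl (polar_arc 0 rho0 (theta + twist_angle 1 1 (rho0 ^+ 2)) (theta + c)) *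
   cl (ray rho0 rho1 (theta + c)))%g.
Proof.
move=> r0 r1 sc ac.
pose rho t := rho0 + t * (rho1 - rho0).
pose H (st : R * R) : C := polar 0 (rho st.2)
  (theta + ((1 - st.1) * twist_angle 1 1 (rho st.2 ^+ 2) + st.1 * c)).
have crho : continuous rho.
  move=> t; apply: cvgD; first exact: cvg_cst.
  by apply: cvgM; [exact: cvg_id|exact: cvg_cst].
have ca : continuous (fun t => twist_angle 1 1 (rho t ^+ 2)).
  apply: continuous_twist_angle => t; try exact: cst_continuous.
  exact: (continuous_compT crho (@exprn_continuous R 2)).
have cH : continuous H.
  apply: continuous_polar; first exact: continuous_compT (@continuous_snd R R) crho.
  move=> st; apply: cvgD; first exact: cvg_cst.
  apply: cvgD; apply: cvgM.
  - by apply: cvgB; [exact: cvg_cst|exact: continuous_fst].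
  - exact: (continuous_compT (@continuous_snd R R) ca).
  - exact: continuous_fst.
  - exact: cvg_cst.
have AH s t : I s -> I t -> A (H (s, t)).
  move=> Is; rewrite /= in_itv /= => /andP[t0 t1].
  have rhob : rho0 <= rho t <= rho1 \/ rho1 <= rho t <= rho0.
    rewrite /rho; case: (leP rho0 rho1) => h; [left|right];
      apply/andP; split; nra.
  have Dt : D (H (s, t)).
    apply: polar_disc; rewrite normr0 add0r /=.
    by move: r0 r1; rewrite !ler_norml; lra.
  have crit : `|rho t| = 1 \/ `|rho t| = 2 -> A (H (s, t)).
    move=> h; apply: punctured_Im => //; rewrite /H /= (ac _ rhob h).
    rewrite -mulrDl subrK mul1r mulf_neq0// -normr_gt0.
    by case: h => ->.
  have [h1|h1] := eqVneq `|rho t| 1; first by apply: crit; left.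
  have [h2|h2] := eqVneq `|rho t| 2; first by apply: crit; right.
  by apply: punctured_norm => //; rewrite norm_polar.
have pathP (f : R -> R * R) : continuous f -> (forall t, I t -> (I `*` I) (f t)) ->
    is_path A (H (f 0)) (H (f 1)) (H \o f).
  move=> cf If; split=> //.
    exact/continuous_subspaceT/(continuous_compT cf cH).
  by move=> t /If[Is It]; have := AH _ _ Is It; rewrite /= -surjective_pairing.
have I0 := I0 R; have I1 := I1 R.
have cst_id (a : R) : continuous (fun t : R => (a, t)).
  by apply: continuous_pair => t; [exact: cst_continuous|exact: cvg_id].
have id_cst (a : R) : continuous (fun t : R => (t, a)).
  by apply: continuous_pair => t; [exact: cvg_id|exact: cst_continuous].
have p1 := pathP _ (cst_id 0) (fun t It => conj I0 It).
have p2 := pathP _ (id_cst 1) (fun t It => conj It I1).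
have p3 := pathP _ (id_cst 0) (fun t It => conj It I0).
have p4 := pathP _ (cst_id 1) (fun t It => conj I1 It).
have := homotopic_square (continuous_subspaceT cH) AH.
move/(cl_eq (is_path_concat p1 p2) (is_path_concat p3 p4)).
rewrite (clM p1 p2) (clM p3 p4).
rewrite (_ : H \o (fun t => (0, t)) = phi \o ray rho0 rho1 theta); last first.
  apply/funext => t; rewrite /= /ray twist_polar /H /= -/(rho t).
  by congr polar; ring.
rewrite (_ : H \o (fun t => (1, t)) = ray rho0 rho1 (theta + c)); last first.
  by apply/funext => t; rewrite /= /ray /H /= -/(rho t); congr polar; ring.
rewrite (_ : H \o (fun t => (t, 1)) =
  polar_arc 0 rho1 (theta + twist_angle 1 1 (rho1 ^+ 2)) (theta + c)); last first.
  apply/funext => t; rewrite /= /polar_arc /H /=.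
  by rewrite (_ : rho 1 = rho1); [congr polar; ring|rewrite /rho; ring].
rewrite (_ : H \o (fun t => (t, 0)) =
  polar_arc 0 rho0 (theta + twist_angle 1 1 (rho0 ^+ 2)) (theta + c)) //.
apply/funext => t; rewrite /= /polar_arc /H /=.
by rewrite (_ : rho 0 = rho0); [congr polar; ring|rewrite /rho; ring].
Qed.

(** The outer strands follow the boundary circle, which the twist fixes; the
    inner ones run along the imaginary axis, strand 1 going round the circle of
    radius 3/2, which is fixed as well, to avoid the puncture -1. *)
Definition strand (k : nat) : R -> C :=
  match k with
  | 0 => polar_arc 0 4 (- (pi / 2)) (- (3 * pi / 2))
  | 1 => concat (concat (ray 4 (3 / 2) (- (pi / 2)))
           (polar_arc 0 (3 / 2) (- (pi / 2)) (- (3 * pi / 2))))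
           (ray (3 / 2) 4 (pi / 2))
  | 2 => concat (concat (ray 4 (3 / 2) (- (pi / 2)))
           (ray (3 / 2) (- (3 / 2)) (- (pi / 2))))
           (ray (3 / 2) 4 (pi / 2))
  | _ => polar_arc 0 4 (- (pi / 2)) (pi / 2)
  end%N.

Let circA rho theta : rho = 4 \/ rho = 3 / 2 -> A (polar 0 rho theta).
Proof.
move=> h; have r0 : 0 <= rho by case: h => ->; lra.
apply: punctured_norm; rewrite ?norm_polar ?ger0_norm//.
- by apply: polar_disc; rewrite normr0 add0r ger0_norm//; case: h => ->; lra.
- by apply/eqP; case: h => ->; lra.
- by apply/eqP; case: h => ->; lra.
Qed.

Let circ4 theta := @circA 4 theta (or_introl erefl).
Let circ3 theta := @circA (3 / 2) theta (or_intror erefl).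

Let arcP rho a b : rho = 4 \/ rho = 3 / 2 ->
  is_path A (polar 0 rho a) (polar 0 rho b) (polar_arc 0 rho a b).
Proof. by move=> h; apply: polar_arc_is_path => theta _; exact: circA. Qed.

Let shift_left : pi / 2 = - (3 * pi / 2) + 2 * pi :> R. Proof. by field. Qed.

Let polar_left rho : polar 0 rho (- (3 * pi / 2)) = polar 0 rho (pi / 2) :> C.
Proof. by rewrite shift_left polarD2pi. Qed.

Let rayP e rho0 rho1 theta : 0 < e * (rho0 * sin theta) ->
  0 < e * (rho1 * sin theta) -> `|rho0| <= 4 -> `|rho1| <= 4 ->
  is_path A (polar 0 rho0 theta) (polar 0 rho1 theta) (ray rho0 rho1 theta).
Proof.
move=> s0 s1 r0 r1; have gap j := @gapP R 0 j isT.
apply: is_path_sub (half_punctured (e := e) gap) _; rewrite ray_segment.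
apply: segment_is_path; first exact: segment_closed_half.
- by apply: half_polar; [rewrite normr0 add0r|left].
- by apply: half_polar; [rewrite normr0 add0r|left].
Qed.

Let down := ray 4 (3 / 2) (- (pi / 2)).
Let inner := ray (3 / 2) (- (3 / 2)) (- (pi / 2)).
Let up := ray (3 / 2) 4 (pi / 2).
Let m := polar 0 (3 / 2) (- (pi / 2)) : C.
Let m' := polar 0 (3 / 2) (pi / 2) : C.

Let n4 : `|4 : R| <= 4. Proof. by rewrite ger0_norm. Qed.
Let n3 : `|3 / 2 : R| <= 4. Proof. by rewrite ger0_norm//; lra. Qed.

Let downP : is_path A u m down.
Proof.
rewrite u0_polar; apply: (@rayP (-1)) => //; rewrite sinN sin_pihalf; lra.
Qed.

Let upP : is_path A m' v up.
Proof. apply: (@rayP 1) => //; rewrite sin_pihalf; lra. Qed.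

Let innerE : inner = concat (segment m 0) (segment 0 m').
Proof.
apply/funext => t; rewrite /inner /ray /concat /m /m'.
case: ifP => _; apply/eqP; rewrite eq_complex /= cosN sinN sin_pihalf cos_pihalf;
  apply/andP; split; apply/eqP; by field.
Qed.

Let half_mid e : half_disc e (gap_lo R 2) (gap_hi R 2) (0 : C).
Proof.
split; first by rewrite /discD /= normr0.
by right; rewrite /gap_lo /gap_hi /= ltrN10 ltr01.
Qed.

Let half_m : half_disc (-1) (gap_lo R 2) (gap_hi R 2) m.
Proof.
apply: half_polar; first by rewrite normr0 add0r.
by left; rewrite sinN sin_pihalf; lra.
Qed.

Let half_m' : half_disc 1 (gap_lo R 2) (gap_hi R 2) m'.
Proof.
apply: half_polar; first by rewrite normr0 add0r.
by left; rewrite sin_pihalf; lra.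
Qed.

Let gap2 j := @gapP R 2 j isT.

Let s0P : is_path (half_disc (-1) (gap_lo R 2) (gap_hi R 2)) m 0 (segment m 0).
Proof. by apply: segment_is_path => //; exact: segment_closed_half. Qed.

Let s1P : is_path (half_disc 1 (gap_lo R 2) (gap_hi R 2)) 0 m' (segment 0 m').
Proof. by apply: segment_is_path => //; exact: segment_closed_half. Qed.

Let innerP : is_path A m m' inner.
Proof.
rewrite innerE; apply: is_path_concat.
  exact: is_path_sub (half_punctured gap2) s0P.
exact: is_path_sub (half_punctured gap2) s1P.
Qed.

Let leftP : is_path A m m' (polar_arc 0 (3 / 2) (- (pi / 2)) (- (3 * pi / 2))).
Proof. by rewrite /m' -polar_left; apply: arcP; right. Qed.

Lemma strand_path k : is_path A u v (strand k).
Proof.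
case: k => [|[|[|k]]] /=.
- by rewrite u0_polar -polar_left; apply: arcP; left.
- exact: is_path_concat (is_path_concat downP leftP) upP.
- exact: is_path_concat (is_path_concat downP innerP) upP.
- by rewrite u0_polar; apply: arcP; left.
Qed.

Let piP : 0 < (pi / 2 : R) < pi.
Proof. by have := pi_gt0 R; lra. Qed.

Let seg_uu : cl (segment u u) = 1%g.
Proof.
apply: (@cl_constant R u); last by move=> t; rewrite /segment subrr scaler0 addr0.
by rewrite u0_polar; exact: circ4.
Qed.

Let seg_vv : cl (segment v v) = 1%g.
Proof.
apply: (@cl_constant R v); last by move=> t; rewrite /segment subrr scaler0 addr0.
exact: circ4.
Qed.

Let c4 : `|0 : R| + 4 <= 4. Proof. by rewrite normr0 add0r. Qed.
Let c3 : `|0 : R| + 3 / 2 <= 4. Proof. by rewrite normr0 add0r; lra. Qed.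
Let pos4 : 0 < 4 :> R. Proof. by []. Qed.
Let pos3 : 0 < 3 / 2 :> R. Proof. by lra. Qed.

(** For the circle of radius 4 the approach from -4i and the departure to 4i
    are constant paths. *)
Lemma crosses_strand k : (k < 4)%N -> crosses k (cl (strand k)).
Proof.
case: k => [|[|[|[|//]]]] _ /=.
- have := @crosses_left R 0 4 (pi / 2) piP pos4 c4 circ4 0 isT.
  rewrite -u0_polar seg_uu seg_vv mul1g mulg1; apply.
  by rewrite /gap_lo /gap_hi /=; lra.
- have := @crosses_left R 0 (3 / 2) (pi / 2) piP pos3 c3 circ3 1 isT.
  rewrite (clM (is_path_concat downP leftP) upP) (clM downP leftP).
  rewrite /down /up !ray_segment -u0_polar; apply.
  by rewrite /gap_lo /gap_hi /=; lra.
- rewrite (clM (is_path_concat downP innerP) upP) (clM downP innerP).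
  rewrite -/inner innerE (clM (is_path_sub (half_punctured gap2) s0P)
    (is_path_sub (half_punctured gap2) s1P)) !mulgA.
  exists 0, (concat down (segment m 0)), (concat (segment 0 m') up).
  have dP : is_path (half_disc (-1) (gap_lo R 2) (gap_hi R 2)) u m down.
    rewrite /down ray_segment -u0_polar; apply: segment_is_path => //.
      exact: segment_closed_half.
    exact: half_u.
  have uP : is_path (half_disc 1 (gap_lo R 2) (gap_hi R 2)) m' v up.
    rewrite /up ray_segment; apply: segment_is_path => //.
      exact: segment_closed_half.
    exact: half_v.
  have sub e := half_punctured (e := e) gap2.
  split; [exact: is_path_concat dP s0P|exact: is_path_concat s1P uP|].
  rewrite (clM (is_path_sub (@sub _) dP) (is_path_sub (@sub _) s0P)).
  by rewrite (clM (is_path_sub (@sub _) s1P) (is_path_sub (@sub _) uP)) !mulgA.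
- have := @crosses_right R 0 4 (pi / 2) piP pos4 c4 circ4 3 isT.
  rewrite -u0_polar seg_uu seg_vv mul1g mulg1; apply.
  by rewrite /gap_lo /gap_hi /=; lra.
Qed.

Let left3 := cl (polar_arc 0 (3 / 2) (- (pi / 2)) (- (3 * pi / 2))).
Let right3 := cl (polar_arc 0 (3 / 2) (- (pi / 2)) (pi / 2)).

(** Both sides pass through the gap on the right of 1. *)
Lemma cl_strand3 : cl (strand 3) = (cl down * right3 * cl up)%g.
Proof.
apply: (@crosses_uniq R 3) => //; first exact: crosses_strand.
have := @crosses_right R 0 (3 / 2) (pi / 2) piP pos3 c3 circ3 3 isT.
rewrite /down /up !ray_segment -u0_polar; apply.
by rewrite /gap_lo /gap_hi /=; lra.
Qed.

(** A full turn from the bottom (resp. the top) of a circle goes up its right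
    half and down its left half (resp. the other way round). *)
Let full_bottom rho : rho = 4 \/ rho = 3 / 2 ->
  cl (polar_arc 0 rho (- (pi / 2)) (- (pi / 2) + 2 * pi)) =
  (cl (polar_arc 0 rho (- (pi / 2)) (pi / 2)) *
   (cl (polar_arc 0 rho (- (pi / 2)) (- (3 * pi / 2))))^-1)%g.
Proof.
move=> h; have cA theta := @circA rho theta h.
rewrite -(cl_arcM _ (pi / 2) _ cA) (cl_arcV _ _ cA); congr (_ * _)%g.
by rewrite -[in RHS]polar_arc_shift -shift_left.
Qed.

Let full_top rho : rho = 4 \/ rho = 3 / 2 ->
  cl (polar_arc 0 rho (pi / 2) (pi / 2 + 2 * pi)) =
  ((cl (polar_arc 0 rho (- (pi / 2)) (- (3 * pi / 2))))^-1 *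
   cl (polar_arc 0 rho (- (pi / 2)) (pi / 2)))%g.
Proof.
move=> h; have cA theta := @circA rho theta h.
rewrite -(cl_arcM _ (- (pi / 2) + 2 * pi) _ cA) (cl_arcV _ _ cA).
rewrite polar_arc_shift; congr (_ * _)%g.
by rewrite -[in RHS]polar_arc_shift -shift_left.
Qed.

Let mid : twist_angle 1 1 ((3 / 2) ^+ 2) = 2 * pi :> R.
Proof. by rewrite -twist_angle_mid; congr twist_angle; field. Qed.

Let bd4 : twist_angle 1 1 (4 ^+ 2) = 0 :> R.
Proof. by rewrite (_ : 4 ^+ 2 = 16) ?twist_angle16//; ring. Qed.

Let crit2 (rho : R) : `|rho| = 2 -> twist_angle 1 1 (rho ^+ 2) = 2 * pi.
Proof.
move=> h; rewrite -(@real_normK _ rho) ?num_real// h.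
by rewrite (_ : 2 ^+ 2 = 4) ?twist_angle4 ?mul1r//; ring.
Qed.

Let crit1 (rho : R) : `|rho| = 1 -> twist_angle 1 1 (rho ^+ 2) = 4 * pi.
Proof.
move=> h; rewrite -(@real_normK _ rho) ?num_real// h expr1n.
by rewrite twist_angle1 mul1r.
Qed.

Let sin_top : sin (pi / 2 + 2 * pi) != 0 :> R.
Proof. by rewrite mulr_natl sinD2pi sin_pihalf oner_neq0. Qed.

Let sin_bottom : sin (- (pi / 2) + 2 * pi) != 0 :> R.
Proof. by rewrite mulr_natl sinD2pi sinN sin_pihalf oppr_eq0 oner_neq0. Qed.

Let cl_arc_trivial (rho a : R) : rho = 4 \/ rho = 3 / 2 ->
  cl (polar_arc 0 rho a a) = 1%g.
Proof.
move=> h; apply: (@cl_constant R (polar 0 rho a)); first exact: circA.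
by move=> t; rewrite /polar_arc subrr mulr0 addr0.
Qed.

(** Between the radii 4 and 3/2 only the modulus 2 is critical; the angle is
    2 pi there and at the inner end, and 0 at the outer end, which therefore
    makes a full turn along the boundary. *)
Let twist_down : cl (phi \o down) = (cl (strand 3) * (cl (strand 0))^-1 * cl down)%g.
Proof.
have := @cl_twist_ray 4 (3 / 2) (- (pi / 2)) (2 * pi) n4 n3 sin_bottom.
rewrite mid bd4 addr0 cl_arc_trivial ?mulg1; last by right.
rewrite full_bottom; last by left.
rewrite rayD2pi; apply => rho h [r1|]; last exact: crit2.
by move: r1; rewrite ger0_norm; lra.
Qed.

Let twist_up : cl (phi \o up) = (cl up * ((cl (strand 0))^-1 * cl (strand 3))^-1)%g.
Proof.
have := @cl_twist_ray (3 / 2) 4 (pi / 2) (2 * pi) n3 n4 sin_top.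
rewrite mid bd4 addr0 cl_arc_trivial ?mul1g; last by right.
rewrite full_top; last by left.
rewrite rayD2pi => <-; first by rewrite mulgK.
move=> rho h [r1|]; last exact: crit2.
by move: r1; rewrite ger0_norm; lra.
Qed.

(** Inside the circle of radius 3/2 only the modulus 1 is critical, and it turns
    by 4 pi, once more than the two ends. *)
Let twist_inner : cl (phi \o inner) =
  (right3 * left3^-1 * cl inner * (left3^-1 * right3)^-1)%g.
Proof.
have fourpi : 4 * pi = 2 * pi + 2 * pi :> R by ring.
have s : sin (- (pi / 2) + 4 * pi) != 0 :> R.
  by rewrite fourpi addrA mulr_natl !sinD2pi sinN sin_pihalf oppr_eq0 oner_neq0.
have := @cl_twist_ray (3 / 2) (- (3 / 2)) (- (pi / 2)) (4 * pi) n3.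
rewrite normrN sqrrN mid => /(_ n3 s).
rewrite polar_arcN (_ : - (pi / 2) + 2 * pi + pi = pi / 2 + 2 * pi); last by field.
rewrite (_ : - (pi / 2) + 4 * pi + pi = pi / 2 + 2 * pi + 2 * pi); last by field.
rewrite fourpi addrA !polar_arc_shift full_top ?full_bottom; try by right.
rewrite !rayD2pi => <-; first by rewrite mulgK.
rewrite -fourpi => rho h [|r2]; first exact: crit1.
exfalso; move: r2; case: (ler0P rho) => _; lra.
Qed.

Lemma cl_twist_strand0 : cl (phi \o strand 0) = cl (strand 0).
Proof. by rewrite twist_arc//; right. Qed.

Lemma cl_twist_strand3 : cl (phi \o strand 3) = cl (strand 3).
Proof. by rewrite twist_arc//; right. Qed.

Lemma phi_based : based_map (base (@Ku0 R)) phi.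
Proof. exact: (braid_based (@Ku0 R) (twist_diffeo R)). Qed.

Let phiP x y (f : R -> C) : is_path A x y f -> is_path A (phi x) (phi y) (phi \o f).
Proof.
have [cphi Aphi _] := phi_based; move=> [cf Af f0 f1]; split.
- exact: within_comp cf Af cphi.
- by move=> t /Af/Aphi.
- by rewrite /= f0.
- by rewrite /= f1.
Qed.

Let phi_concat (f g : R -> C) : phi \o concat f g = concat (phi \o f) (phi \o g).
Proof. by apply/funext => t; rewrite /concat /=; case: ifP. Qed.

(** In the notation e_k for the class of the strand k, the factors around are
    e_3 e_0^-1, a full turn from -4i, and e_0^-1 e_3, a full turn from 4i. *)
Lemma cl_twist_strand1 : cl (phi \o strand 1) =
  (cl (strand 3) * (cl (strand 0))^-1 * cl (strand 1) *
   ((cl (strand 0))^-1 * cl (strand 3))^-1)%g.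
Proof.
rewrite /= !phi_concat.
rewrite (clM (is_path_concat (phiP downP) (phiP leftP)) (phiP upP)).
rewrite (clM (phiP downP) (phiP leftP)) twist_down twist_up.
rewrite twist_arc; last by left.
by rewrite (clM (is_path_concat downP leftP) upP) (clM downP leftP) !mulgA.
Qed.

(** The further factors e_3 e_1^-1 and e_1^-1 e_3 are the full turns along the
    circle of radius 3/2, joined to -4i and to 4i. *)
Lemma cl_twist_strand2 : cl (phi \o strand 2) =
  (cl (strand 3) * (cl (strand 0))^-1 * (cl (strand 3) * (cl (strand 1))^-1) *
   cl (strand 2) * ((cl (strand 1))^-1 * cl (strand 3))^-1 *
   ((cl (strand 0))^-1 * cl (strand 3))^-1)%g.
Proof.
rewrite {1}/strand !phi_concat.
rewrite (clM (is_path_concat (phiP downP) (phiP innerP)) (phiP upP)).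
rewrite (clM (phiP downP) (phiP innerP)) twist_down twist_inner twist_up.
have e1 : cl (strand 1) = (cl down * left3 * cl up)%g.
  by rewrite (clM (is_path_concat downP leftP) upP) (clM downP leftP).
have e2 : cl (strand 2) = (cl down * cl inner * cl up)%g.
  by rewrite (clM (is_path_concat downP innerP) upP) (clM downP innerP).
rewrite e1 e2; have := cl_strand3; move: (cl (strand 3)) => E3 ->.
move: (cl (strand 0)) (cl down) (cl inner) (cl up) left3 right3 => E0 a n c l r.
by rewrite !invgM !invgK !mulgA !mulgK !mulgVK.
Qed.

Lemma cl_twist_loop (i : 'I_3) (r : R) (hr : 0 < r < 1) :
  gbase hr i = (cl (strand i.+1) * (cl (strand i))^-1)%g /\
  braid_act (twist_braid R) (gbase hr i) =
    (cl (phi \o strand i.+1) * (cl (phi \o strand i))^-1)%g.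
Proof.
have sP k := strand_path k.
have lP := is_path_concat (sP i.+1) (is_path_rev (sP i)).
have clE : cl (concat (strand i.+1) (rev_path (strand i))) =
    (cl (strand i.+1) * (cl (strand i))^-1)%g.
  by rewrite (clM (sP _) (is_path_rev (sP _))) (clV (sP _)).
have gE : gbase hr i = pi1_class (@Loop _ _ _ (base (@Ku0 R)) _ lP).
  rewrite -(@path_class_loop _ _ _ (base (@Ku0 R)) _ lP) /gbase -path_class_loop clE.
  have [e [e' [c c' ->]]] := cl_lasso i hr.
  have i4 : (i.+1 < 4)%N := ltn_ord i.
  rewrite (crosses_uniq i4 c (crosses_strand i4)).
  by rewrite (crosses_uniq (ltnW i4) c' (crosses_strand (ltnW i4))).
split; first by rewrite gE -path_class_loop clE.
rewrite /twist_braid braid_actE gE /braid_diffeo_pi1 pi1_mapE -path_class_loop.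
transitivity (cl (phi \o concat (strand i.+1) (rev_path (strand i)))); first by [].
rewrite phi_concat.
have -> : phi \o rev_path (strand i) = rev_path (phi \o strand i) by [].
have pP k := phiP (sP k).
by rewrite (clM (pP _) (is_path_rev (pP _))) (clV (pP _)).
Qed.

Lemma twist_braid_relations (r : R) (hr : 0 < r < 1) :
  let x1 := gbase hr 0 in
  let x2 := gbase hr 1 in
  let x3 := gbase hr 2 in
  relation_closure
    [set (braid_act (twist_braid R) (gbase hr j), gbase hr j) | j in [set: 'I_3]] =
  relation_closure
    [set ((x1 * x3 * x2)%g, (x3 * x2 * x1)%g);
         ((x3 * x2 * x1 * x3 * x2)%g, (x2 * x3 * x2 * x1 * x3)%g)].
Proof.
move=> x1 x2 x3.
have [e1 b1] := cl_twist_loop 0 hr.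
have [e2 b2] := cl_twist_loop 1 hr.
have [e3 b3] := cl_twist_loop 2 hr.
have {}e1 : x1 = (cl (strand 1) * (cl (strand 0))^-1)%g by exact: e1.
have {}e2 : x2 = (cl (strand 2) * (cl (strand 1))^-1)%g by exact: e2.
have {}e3 : x3 = (cl (strand 3) * (cl (strand 2))^-1)%g by exact: e3.
apply: (@twist_relations _ x1 x2 x3); congr pair.
- rewrite b1 cl_twist_strand1 cl_twist_strand0 e1 e2 e3.
  move: (cl (strand 0)) (cl (strand 1)) (cl (strand 2)) (cl (strand 3)).
  by move=> E0 E1 E2 E3; rewrite !invgM !invgK !mulgA !(mulgK, mulgVK).
- rewrite b2 cl_twist_strand2 cl_twist_strand1 e1 e2 e3.
  move: (cl (strand 0)) (cl (strand 1)) (cl (strand 2)) (cl (strand 3)).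
  by move=> E0 E1 E2 E3; rewrite !invgM !invgK !mulgA !(mulgK, mulgVK).
- rewrite b3 cl_twist_strand3 cl_twist_strand2 e1 e2 e3.
  move: (cl (strand 0)) (cl (strand 1)) (cl (strand 2)) (cl (strand 3)).
  by move=> E0 E1 E2 E3; rewrite !invgM !invgK !mulgA !(mulgK, mulgVK).
Qed.

End action.

Theorem theorem4p1 (R : realType) :
  exists beta : braid (@Ku0 R),
    [/\ forall beta', local_braid_monodromy 3 beta' <-> beta' = beta,
        forall beta', induced_braid (@twist_motion R) beta' <-> beta' = beta
      & forall (r : R) (hr : 0 < r < 1),
          let x1 := gbase hr 0 in
          let x2 := gbase hr 1 in
          let x3 := gbase hr 2 in
          relation_closure
            [set (braid_act beta (gbase hr j), gbase hr j) | j in [set: 'I_3]] =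
          relation_closure
            [set ((x1 * x3 * x2)%g, (x3 * x2 * x1)%g);
                 ((x3 * x2 * x1 * x3 * x2)%g, (x2 * x3 * x2 * x1 * x3)%g)]].
Proof.
exists (twist_braid R); split.
- exact: local_monodromy_braid.
- exact: twist_motion_braid.
- by move=> r hr x1 x2 x3; exact: twist_braid_relations.
Qed.
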